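(* Let $p\in(0,1)$ be fixed and let $G_{n;\nu_1,\nu_2}(p)$ be the random bipartite graph on $[n]$ with parts $V_1,V_2$ of sizes $n\nu_1(n)$ and $n\nu_2(n)$, where $\lim_{n\to\infty}\nu_i(n)>0$ for $i=1,2$ and $\nu_2/\nu_1\to y\in(0,\infty)$ as $n\to\infty$. Put $a=p(1-p)(1-\sqrt y)^2$, $b=p(1-p)(1+\sqrt y)^2$ and $$\Lambda=\int_{\sqrt a}^{\sqrt b}\frac{1}{\pi p(1-p)y}\sqrt{(b-x^2)(x^2-a)}\,dx.$$ Then almost every random bipartite graph $G_{n;\nu_1,\nu_2}(p)$ satisfies $$\mathscr{E}(G_{n;\nu_1,\nu_2}(p))=\left(2\nu_2\sqrt{\nu_1}\,\Lambda+o(1)\right)n^{3/2}.$$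
   Context: For a simple graph $G$ with adjacency matrix eigenvalues $\lambda_1,\dots,\lambda_n$ (with multiplicity), the energy is $\mathscr{E}(G)=\sum_{i=1}^n|\lambda_i|$. The set $[n]=\{1,\dots,n\}$ is partitioned into $V_1,V_2$ with $|V_i|=n\nu_i(n)$ (so $\nu_1+\nu_2=1$), and $G_{n;\nu_1,\nu_2}(p)$ is obtained by including each edge between $V_1$ and $V_2$ independently with probability $p$ (no edges inside parts). ''Almost every'' graph has a property if its probability tends to $1$ as $n\to\infty$; the asymptotic equality with $o(1)$ means that for each $\varepsilon>0$, with probability tending to $1$, the error term is at most $\varepsilon$ in absolute value. *)

(* Defs.v *)
From HB Require Import structures.
From mathcomp Require Import all_boot all_order all_algebra.
From mathcomp Require Import all_classical all_reals all_analysis.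
From mathcomp Require Import complex.

Set Implicit Arguments.
Unset Strict Implicit.
Unset Printing Implicit Defensive.

Import Order.TTheory GRing.Theory Num.Theory.
Import numFieldNormedType.Exports.

Local Open Scope ring_scope.
Local Open Scope complex_scope.

(* The vertex set [n] is 'I_n; an edge is an unordered pair of distinct
   vertices, i.e. a 2-element set. *)
Record sgraph (n : nat) := SGraph {
  edges : {set {set 'I_n}};
  edges_card2 : [forall e in edges, #|e| == 2]
}.

HB.instance Definition _ n := [isSub for @edges n].
HB.instance Definition _ n := [Equality of sgraph n by <:].
HB.instance Definition _ n := [Choice of sgraph n by <:].
HB.instance Definition _ n := [Countable of sgraph n by <:].
HB.instance Definition _ n := [Finite of sgraph n by <:].

Definition adjacency (R : realType) n (G : sgraph n) : 'M[R]_n :=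
  \matrix_(i, j) ([set i; j] \in edges G)%:R.

(* All n complex roots of the characteristic polynomial, each repeated
   according to its multiplicity. *)
Definition eigenvalues (R : realType) n (A : 'M[R]_n) : seq R[i] :=
  sval (closed_field_poly_normal
          (char_poly (map_mx (real_complex R) A))).

(* [Normc.normc] is the complex modulus, with values in R. *)
Definition energy (R : realType) n (G : sgraph n) : R :=
  \sum_(z <- eigenvalues (adjacency R G)) Normc.normc z.

Section RandomBipartiteGraph.
Variables (R : realType) (p : R).

Definition cross_edges n (V1 V2 : {set 'I_n}) : {set {set 'I_n}} :=
  \bigcup_(u in V1) \bigcup_(v in V2) [set [set u; v]].

(* The law of the random bipartite graph: under the product of Bernoulli(p)
   laws over the pairs in V1 x V2, the probability that G is obtained. *)
Definition bipartite_mass n (V1 V2 : {set 'I_n}) (G : sgraph n) : R :=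
  if edges G \subset cross_edges V1 V2 then
    \prod_(e in cross_edges V1 V2) (if e \in edges G then p else 1 - p)
  else 0.

Definition bipartite_prob n (V1 V2 : {set 'I_n}) (Q : pred (sgraph n)) : R :=
  \sum_(G | Q G) bipartite_mass V1 V2 G.

Definition almost_every_bipartite (V1 V2 : forall n, {set 'I_n})
    (Q : forall n, pred (sgraph n)) : Prop :=
  (bipartite_prob (V1 n) (V2 n) (Q n) @[n --> \oo] --> (1 : R))%classic.

End RandomBipartiteGraph.

Definition Lambda (R : realType) (p y : R) : R :=
  let a := p * (1 - p) * (1 - Num.sqrt y) ^+ 2 in
  let b := p * (1 - p) * (1 + Num.sqrt y) ^+ 2 in
  \int[lebesgue_measure]_(x in `[Num.sqrt a, Num.sqrt b]%classic)
    ((pi * p * (1 - p) * y)^-1 * Num.sqrt ((b - x ^+ 2) * (x ^+ 2 - a))).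

(* Main.v *)
Require Import Defs.
From mathcomp Require Import all_boot all_order all_algebra.
From mathcomp Require Import all_classical all_reals all_analysis.
From mathcomp Require Import complex.
From mathcomp Require Import ring lra.
Set Implicit Arguments.
Unset Strict Implicit.
Unset Printing Implicit Defensive.
Import Order.TTheory GRing.Theory Num.Theory.
Import numFieldNormedType.Exports.
Local Open Scope ring_scope.

(** A real resolvent version of the Marchenko-Pastur argument, with no moments and no
    complex analysis.  Coulson's formula [|r| = 2/pi * int_0^oo r^2/(r^2+t^2) dt], replaced
    by a Riemann sum over finitely many [t = j h] with a uniform error, expresses
    the energy through traces of [(A^2 + n t^2)^-1].  The bipartite structure turns these into
    [tau(t)], the trace over [V2] of [(X^T X + n t^2)^-1], where [X] may be taken centred since
    the mean of the biadjacency matrix changes [X^T X] only by rank-one terms, each of which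
    moves the trace by at most [1/(n t^2)].

    Removing the row [x_k] of [X] (Sherman-Morrison) gives
    [sum_k q_k/(1+q_k) + n t^2 tau = |V2|] with [q_k = x_k R_k x_k^T], [R_k] being independent of
    [x_k]; as a quadratic form, [q_k] concentrates at [p(1-p) tau].  So [tau] is an approximate
    solution of [nu1 f(p(1-p) tau) + t^2 tau = nu2] with [f(q) = q/(1+q)], an equation which is
    increasing in [tau] and hence stable: no concentration of [tau] around its mean is needed.
    For the limiting proportions [l1], [l2] the exact solution has [l2 - t^2 tau] equal to
    [l2 int x^2/(x^2 + t^2/l1) dmu(x)], where [x dmu(x)] is the integrand of [Lambda]; the integral
    is computed from an explicit primitive, and the same Riemann sum leads back to [Lambda]. *)

(** * Resolvents of positive semidefinite matrices *)

Definition dotr (R : pzRingType) n (u v : 'rV[R]_n) : R := \sum_j u 0 j * v 0 j.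

(** Symmetry is a separate clause because over a real field a nonnegative quadratic form does not
    force it. *)
Definition psdmx (R : numDomainType) n (N : 'M[R]_n) :=
  N^T = N /\ forall v : 'rV_n, 0 <= dotr (v *m N) v.

(** This is [X^T X] for the matrix [X] with rows [x k]. Indexing by a subset of ['I_n] keeps all
    matrices square of size [n], and removing a row is passing to [K :\ k]. *)
Definition gram (R : pzRingType) n (K : {set 'I_n}) (x : 'I_n -> 'rV[R]_n) : 'M[R]_n :=
  \sum_(k in K) (x k)^T *m x k.

Definition resolvent (R : comUnitRingType) n (N : 'M[R]_n) (eta : R) : 'M[R]_n :=
  invmx (N + eta%:M).

Definition ptrace (R : pzRingType) n (D : {set 'I_n}) (M : 'M[R]_n) : R :=
  \sum_(i in D) M i i.

Lemma dotrE (R : pzRingType) n (u v : 'rV[R]_n) : dotr u v = (u *m v^T) 0 0.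
Proof. by rewrite mxE; apply: eq_bigr => j _; rewrite mxE. Qed.

Lemma dotrDl (R : pzRingType) n (u v w : 'rV[R]_n) : dotr (u + v) w = dotr u w + dotr v w.
Proof. by rewrite !dotrE mulmxDl mxE. Qed.

Lemma dotrZl (R : pzRingType) n a (u v : 'rV[R]_n) : dotr (a *: u) v = a * dotr u v.
Proof. by rewrite !dotrE -scalemxAl mxE. Qed.

Lemma dotrC (R : comPzRingType) n (u v : 'rV[R]_n) : dotr u v = dotr v u.
Proof. by apply: eq_bigr => j _; rewrite mulrC. Qed.

Lemma dotr_ge0 (R : realDomainType) n (u : 'rV[R]_n) : 0 <= dotr u u.
Proof. by apply: sumr_ge0 => j _; rewrite -expr2 sqr_ge0. Qed.

Lemma dotr_eq0 (R : realDomainType) n (u : 'rV[R]_n) : dotr u u = 0 -> u = 0.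
Proof.
move=> u0; apply/rowP => j; rewrite !mxE.
have /psumr_eq0P : forall i : 'I_n, true -> 0 <= u 0 i * u 0 i.
  by move=> i _; rewrite -expr2 sqr_ge0.
by move=> /(_ u0 j isT) /eqP; rewrite mulf_eq0 orbb => /eqP.
Qed.

Lemma mulmx_rank1 (R : pzRingType) n (w v u : 'rV[R]_n) :
  w *m (v^T *m u) = dotr w v *: u.
Proof. by rewrite mulmxA [w *m _]mx11_scalar -dotrE mul_scalar_mx. Qed.

Lemma psdmxD (R : numDomainType) n (N M : 'M[R]_n) : psdmx N -> psdmx M -> psdmx (N + M).
Proof.
move=> [sN pN] [sM pM]; split; first by rewrite linearD /= sN sM.
by move=> v; rewrite mulmxDr dotrDl addr_ge0.
Qed.

Lemma psdmx_rank1 (R : realDomainType) n (x : 'rV[R]_n) : psdmx (x^T *m x).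
Proof.
split; first by rewrite trmx_mul trmxK.
by move=> v; rewrite mulmx_rank1 dotrZl dotrC -expr2 sqr_ge0.
Qed.

Lemma psdmx_gram (R : realDomainType) n (K : {set 'I_n}) (x : 'I_n -> 'rV[R]_n) :
  psdmx (gram K x).
Proof.
apply: (big_ind (@psdmx R n)); last by move=> k _; apply: psdmx_rank1.
- by split; [rewrite linear0 | move=> v; rewrite mulmx0 /dotr big1 // => j _; rewrite mxE mul0r].
- exact: psdmxD.
Qed.

(** A kernel vector [v] satisfies [v N v^T + eta |v|^2 = 0] with both terms nonnegative, so it
    vanishes. *)
Lemma resolvent_unit (R : realFieldType) n (N : 'M[R]_n) eta :
  psdmx N -> 0 < eta -> N + eta%:M \in unitmx.
Proof.
move=> [_ pN] eta0; rewrite -row_free_unit -kermx_eq0; apply/eqP/eqP/rowV0P => v /sub_kermxP.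
rewrite mulmxDr mul_mx_scalar => v0; apply: dotr_eq0.
have := congr1 (fun w => dotr w v) v0; rewrite /= dotrDl dotrZl.
have -> : dotr 0 v = 0 :> R by rewrite /dotr big1 // => j _; rewrite mxE mul0r.
have := pN v; have := dotr_ge0 v; nra.
Qed.

Lemma mulmx_resolvent (R : realFieldType) n (N : 'M[R]_n) eta :
  psdmx N -> 0 < eta -> (N + eta%:M) *m resolvent N eta = 1%:M.
Proof. by move=> pN e0; rewrite mulmxV // resolvent_unit. Qed.

Lemma mul_resolvent_mx (R : realFieldType) n (N : 'M[R]_n) eta :
  psdmx N -> 0 < eta -> resolvent N eta *m (N + eta%:M) = 1%:M.
Proof. by move=> pN e0; rewrite mulVmx // resolvent_unit. Qed.

Lemma resolvent_uniq (R : realFieldType) n (N X : 'M[R]_n) eta :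
  psdmx N -> 0 < eta -> X *m (N + eta%:M) = 1%:M -> X = resolvent N eta.
Proof.
move=> pN e0 XN; rewrite -[X]mulmx1 -(mulmx_resolvent pN e0) mulmxA XN mul1mx //.
Qed.

Lemma trmx_resolvent (R : realFieldType) n (N : 'M[R]_n) eta :
  psdmx N -> (resolvent N eta)^T = resolvent N eta.
Proof. by move=> [sN _]; rewrite trmx_inv linearD /= sN tr_scalar_mx. Qed.

(** With [u = v (N + eta)^-1], pairing [v = u (N + eta)] with [u] gives [u N u^T + eta |u|^2], and
    the first term is nonnegative. *)
Lemma resolvent_dot_ge (R : realFieldType) n (N : 'M[R]_n) eta (v : 'rV_n) :
  psdmx N -> 0 < eta ->
  eta * dotr (v *m resolvent N eta) (v *m resolvent N eta) <= dotr (v *m resolvent N eta) v.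
Proof.
move=> pN e0; set u := v *m _.
have -> : dotr u v = dotr (u *m (N + eta%:M)) u.
  by rewrite dotrC -mulmxA mul_resolvent_mx // mulmx1.
rewrite mulmxDr mul_mx_scalar dotrDl dotrZl lerDr; exact: pN.2.
Qed.

Lemma resolvent_norm_le (R : realFieldType) n (N : 'M[R]_n) eta (v : 'rV_n) :
  psdmx N -> 0 < eta ->
  dotr (v *m resolvent N eta) (v *m resolvent N eta) <= dotr v v / eta ^+ 2.
Proof.
move=> pN e0; have := resolvent_dot_ge v pN e0; set u := v *m _ => h.
(* Expanding this square takes the place of Cauchy-Schwarz: together with [eta |u|^2 <= <u, v>] it
   yields [eta^2 |u|^2 <= |v|^2]. *)
have := dotr_ge0 (v - eta *: u).
have -> : v - eta *: u = v + (- eta) *: u by rewrite scaleNr.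
rewrite dotrDl dotrZl ![dotr _ (v + _)]dotrC !dotrDl !dotrZl [dotr v u]dotrC => h2.
rewrite ler_pdivlMr ?exprn_gt0 //.
have : eta * (eta * dotr u u) <= eta * dotr u v by rewrite ler_pM2l.
nra.
Qed.

(** Each row is the image of a unit basis vector, hence has squared norm at most [eta^-2]. *)
Lemma resolvent_frobenius (R : realFieldType) n (N : 'M[R]_n) eta :
  psdmx N -> 0 < eta ->
  \sum_i \sum_j resolvent N eta i j ^+ 2 <= n%:R / eta ^+ 2.
Proof.
move=> pN e0.
have -> : n%:R / eta ^+ 2 = \sum_(i < n) (eta ^+ 2)^-1.
  by rewrite sumr_const card_ord mulr_natl.
apply: ler_sum => i _; have := resolvent_norm_le (delta_mx 0 i) pN e0.
have -> : dotr (delta_mx 0 i) (delta_mx 0 i) = 1 :> R.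
  rewrite /dotr (bigD1 i) //= big1 ?mxE ?eqxx ?mulr1 ?addr0 // => j ji.
  by rewrite !mxE (negbTE ji) andbF mul0r.
rewrite -rowE /dotr mul1r.
by under eq_bigr => j _ do rewrite !mxE -expr2.
Qed.

Lemma ptrace_resolvent_ge0 (R : realFieldType) n (D : {set 'I_n}) (N : 'M[R]_n) eta :
  psdmx N -> 0 < eta -> 0 <= ptrace D (resolvent N eta).
Proof.
move=> pN e0; apply: sumr_ge0 => i _.
have := resolvent_dot_ge (delta_mx 0 i) pN e0.
rewrite [X in _ <= X -> _]dotrE -rowE.
rewrite [X in _ <= X -> _](_ : _ = resolvent N eta i i); last first.
  rewrite mxE (bigD1 i) //= big1 ?addr0 => [|j /negbTE ji]; rewrite !mxE ?eqxx ?mulr1 //.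
  by rewrite ji andbF mulr0.
by apply: le_trans; rewrite mulr_ge0 ?dotr_ge0 // ltW.
Qed.

(** * Rank-one updates and removal of a row *)

Lemma sherman_morrison (R : realFieldType) n (N : 'M[R]_n) eta (x : 'rV_n) :
  psdmx N -> 0 < eta -> let u := x *m resolvent N eta in
  resolvent (N + x^T *m x) eta
  = resolvent N eta - (1 + dotr u x)^-1 *: (u^T *m u).
Proof.
move=> pN e0 u; set q := dotr u x.
have q0 : 0 <= q.
  by apply: le_trans (resolvent_dot_ge x pN e0); rewrite mulr_ge0 ?dotr_ge0 // ltW.
have q1 : 1 + q != 0 by rewrite gt_eqF // ltr_pwDl.
(* It is enough to check a left inverse; since [u (N + eta) = x], every correction term is a
   multiple of [u^T x], and the multiples cancel. *)
apply/esym/resolvent_uniq => //; first by apply: psdmxD => //; apply: psdmx_rank1.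
rewrite mulmxBl -scalemxAl -[u^T *m u *m _]mulmxA.
rewrite addrAC !(mulmxDr _ _ (x^T *m x)) mul_resolvent_mx //.
have -> : u *m (N + eta%:M) = x by rewrite -mulmxA mul_resolvent_mx // mulmx1.
have -> : resolvent N eta *m (x^T *m x) = u^T *m x.
  by rewrite mulmxA trmx_mul trmx_resolvent.
rewrite mulmx_rank1 -/q mulmxDr -scalemxAr -[X in X + _ *: _]scale1r -scalerDl.
by rewrite scalerA mulVf // scale1r addrK.
Qed.

(** This trades a resolvent that contains [x] for one that does not, which is what lets independence
    of rows be used later. *)
Lemma resolvent_rank1_dot (R : realFieldType) n (N : 'M[R]_n) eta (x : 'rV_n) :
  psdmx N -> 0 < eta -> let q := dotr (x *m resolvent N eta) x in
  dotr (x *m resolvent (N + x^T *m x) eta) x = q / (1 + q).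
Proof.
move=> pN e0 q; rewrite sherman_morrison //; set u := x *m resolvent N eta.
have q0 : 0 <= q.
  by apply: le_trans (resolvent_dot_ge x pN e0); rewrite mulr_ge0 ?dotr_ge0 // ltW.
have q1 : 1 + q != 0 by rewrite gt_eqF // ltr_pwDl.
rewrite mulmxBr -scalemxAr mulmx_rank1 -/u scalerA -scaleNr dotrDl dotrZl.
rewrite [dotr x u]dotrC -/q; by field.
Qed.

(** By Sherman-Morrison the difference is the squared norm of [u] over [D] divided by [1 + q], and
    [eta |u|^2 <= q]. *)
Lemma ptrace_rank1 (R : realFieldType) n (D : {set 'I_n}) (N : 'M[R]_n) eta (x : 'rV_n) :
  psdmx N -> 0 < eta ->
  0 <= ptrace D (resolvent N eta) - ptrace D (resolvent (N + x^T *m x) eta) <= eta^-1.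
Proof.
move=> pN e0; rewrite sherman_morrison //; set u := x *m resolvent N eta; set q := dotr u x.
have uq : eta * dotr u u <= q by apply: resolvent_dot_ge.
have q0 : 0 <= q.
  by apply: le_trans uq; rewrite mulr_ge0 ?dotr_ge0 // ltW.
have -> : ptrace D (resolvent N eta) -
  ptrace D (resolvent N eta - (1 + q)^-1 *: (u^T *m u)) =
  (1 + q)^-1 * \sum_(i in D) u 0 i * u 0 i.
  rewrite /ptrace -sumrB mulr_sumr; apply: eq_bigr => i _.
  rewrite !mxE opprB addrC subrK; congr (_ * _).
  by rewrite big_ord1 !mxE.
have s0 : 0 <= \sum_(i in D) u 0 i * u 0 i.
  by apply: sumr_ge0 => i _; rewrite -expr2 sqr_ge0.
have s1 : \sum_(i in D) u 0 i * u 0 i <= dotr u u.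
  rewrite /dotr [leRHS](bigID (mem D)) /= lerDl.
  by apply: sumr_ge0 => i _; rewrite -expr2 sqr_ge0.
rewrite mulr_ge0 ?invr_ge0 ?addr_ge0 //= ler_pdivrMl ?ltr_pwDl //.
rewrite ler_pdivlMr //.
have : (\sum_(i in D) u 0 i * u 0 i) * eta <= dotr u u * eta by rewrite ler_pM2r.
lra.
Qed.

(** Take the trace over [D] of [(gram K x + eta) G = 1]. Row [k] contributes [x_k G x_k^T], because
    [x_k] lives on [D], and removing that row turns this into [q k / (1 + q k)]. *)
Lemma self_consistent_eq (R : realFieldType) n (K D : {set 'I_n}) (x : 'I_n -> 'rV[R]_n) eta :
  0 < eta -> (forall k j, j \notin D -> x k 0 j = 0) ->
  let q k := dotr (x k *m resolvent (gram (K :\ k) x) eta) (x k) in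
  \sum_(k in K) q k / (1 + q k) + eta * ptrace D (resolvent (gram K x) eta) = #|D|%:R.
Proof.
move=> e0 xD q; set G := resolvent _ _.
have pK := psdmx_gram K x.
have -> : \sum_(k in K) q k / (1 + q k) = \sum_(k in K) dotr (x k *m G) (x k).
  apply: eq_bigr => k kK; rewrite -resolvent_rank1_dot //; last exact: psdmx_gram.
  congr (dotr (_ *m resolvent _ _) _).
  by rewrite /gram (big_setD1 k kK) /= addrC.
have -> : #|D|%:R = ptrace D (1%:M : 'M[R]_n).
  by rewrite /ptrace (eq_bigr (fun=> 1)) ?sumr_const // => i _; rewrite mxE eqxx.
rewrite -(mulmx_resolvent pK e0) -/G mulmxDl mul_scalar_mx /ptrace mulr_sumr.
rewrite -[RHS]/(\sum_(i in D) (gram K x *m G + eta *: G) i i).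
under [in RHS]eq_bigr => i _ do rewrite mxE [(eta *: G) i i]mxE.
rewrite big_split /=; congr (_ + _).
have -> : \sum_(i in D) (gram K x *m G) i i =
    \sum_(i in D) \sum_(k in K) ((x k)^T *m x k *m G) i i.
  by apply: eq_bigr => i _; rewrite /gram mulmx_suml summxE.
rewrite [RHS]exchange_big /=; apply: eq_bigr => k _.
rewrite /dotr (bigID (mem D)) /= addrC big1 ?add0r => [|j jD]; last by rewrite xD // mulr0.
apply: eq_bigr => i _; rewrite -mulmxA [in RHS]mxE big_ord1 mxE mulrC.
by rewrite [(x k)^T _ _]mxE.
Qed.

(** The second moment is the variance plus the square of the mean: the cross terms combine into a
    multiple of [z^T z]. *)
Lemma gram_mean (R : numFieldType) n (K : {set 'I_n}) (y : 'I_n -> 'rV[R]_n) m :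
  m = #|K|%:R -> m != 0 -> let z := m^-1 *: \sum_(k in K) y k in
  gram K y = gram K (fun k => y k - z) + m *: (z^T *m z).
Proof.
move=> mE m0 z; rewrite /gram.
have sy : \sum_(k in K) y k = m *: z by rewrite scalerA mulfV // scale1r.
clearbody z.
have -> : \sum_(k in K) (y k - z)^T *m (y k - z) =
    \sum_(k in K) ((y k)^T *m y k - (y k)^T *m z - (z^T *m y k - z^T *m z)).
  by apply: eq_bigr => k _; rewrite [(y k - z)^T]linearB mulmxBl !mulmxBr.
rewrite !sumrB -!mulmx_sumr -!mulmx_suml -linear_sum /= sy !linearZ /= -!scalemxAl.
by rewrite sumr_const -scaler_nat -mE -scalemxAr subrr subr0 subrK.
Qed.

(** This permits passing from 0-1 entries to centred ones. Both traces lie in the same interval of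
    length [eta^-1] below the trace of the centred Gram matrix, so the bound does not double. *)
Lemma ptrace_translation (R : rcfType) n (K D : {set 'I_n}) (x : 'I_n -> 'rV[R]_n)
    (c : 'rV_n) eta : (0 < #|K|)%N -> 0 < eta ->
  `|ptrace D (resolvent (gram K (fun k => x k + c)) eta)
    - ptrace D (resolvent (gram K x) eta)| <= eta^-1.
Proof.
move=> K0 e0; set m : R := #|K|%:R.
have m0 : 0 < m by rewrite ltr0n.
have sq (z : 'rV[R]_n) :
    (Num.sqrt m *: z)^T *m (Num.sqrt m *: z) = m *: (z^T *m z).
  by rewrite [(_ *: z)^T]linearZ -scalemxAl -scalemxAr scalerA /= -expr2 sqr_sqrtr // ltW.
(* both Gram matrices are rank-one updates of the same centred one *)
have rank1 (y : 'I_n -> 'rV[R]_n) (z := m^-1 *: \sum_(k in K) y k) :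
    gram K y = gram K (fun k => y k - z) + (Num.sqrt m *: z)^T *m (Num.sqrt m *: z).
  by rewrite (gram_mean y (erefl m)) ?gt_eqF // -/z sq.
set y := fun k => x k + c.
have centred : gram K (fun k => y k - m^-1 *: \sum_(k in K) y k) =
    gram K (fun k => x k - m^-1 *: \sum_(k in K) x k).
  apply: eq_bigr => k _.
  suff -> : y k - m^-1 *: \sum_(k in K) y k = x k - m^-1 *: \sum_(k in K) x k by [].
  rewrite big_split /= sumr_const -scaler_nat -/m scalerDr scalerA mulVf ?gt_eqF //.
  by rewrite scale1r /y opprD addrACA subrr addr0.
set C := gram K (fun k => x k - _) in centred.
have pC : psdmx C by apply: psdmx_gram.
rewrite (rank1 x) (rank1 y) centred.
set u := Num.sqrt m *: _; set v := Num.sqrt m *: _.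
have := ptrace_rank1 D u pC e0; have := ptrace_rank1 D v pC e0.
set a := ptrace _ _; set b := ptrace _ _; set c' := ptrace _ _.
rewrite -/C ler_norml -/c'; lra.
Qed.

(** * Resolvent traces of a bipartite adjacency matrix *)

Lemma psdmx_mulT (R : realDomainType) n (Y : 'M[R]_n) : psdmx (Y^T *m Y).
Proof.
split; first by rewrite trmx_mul trmxK.
move=> v; have -> : dotr (v *m (Y^T *m Y)) v = dotr (v *m Y^T) (v *m Y^T).
  by rewrite !dotrE trmx_mul trmxK !mulmxA.
exact: dotr_ge0.
Qed.

(** For positive semidefinite [N], [n - eta tr R] is the trace of [N R]. Here [A^2] splits into
    [Y^T Y] and [Y Y^T], which annihilate each other and contribute equally, having the same nonzero
    spectrum. *)
Lemma trace_bipartite (R : realFieldType) n (Y : 'M[R]_n) eta (A := Y + Y^T) :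
  Y *m Y = 0 -> 0 < eta ->
  n%:R - eta * \tr (resolvent (A *m A) eta)
    = 2 * (n%:R - eta * \tr (resolvent (Y^T *m Y) eta)).
Proof.
move=> YY e0.
have YTYT : Y^T *m Y^T = 0 by rewrite -trmx_mul YY linear0.
have AA : A *m A = Y^T *m Y + Y *m Y^T.
  by rewrite mulmxDl !mulmxDr YY YTYT add0r addr0 addrC.
have tr_compl (N : 'M[R]_n) : psdmx N ->
    n%:R - eta * \tr (resolvent N eta) = \tr (N *m resolvent N eta).
  move=> pN; rewrite -[n%:R]mxtrace1 -(mulmx_resolvent pN e0) mulmxDl mul_scalar_mx.
  by rewrite linearD /= linearZ /= addrK.
have pY := psdmx_mulT Y.
have pYT : psdmx (Y *m Y^T) by rewrite -{1}[Y]trmxK; apply: psdmx_mulT.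
have pA : psdmx (A *m A).
  by rewrite AA; apply: psdmxD.
rewrite !tr_compl //.
(* Adding a summand that [N] annihilates leaves [N] times its resolvent unchanged. *)
have block (N M : 'M[R]_n) : psdmx N -> psdmx M -> N *m M = 0 ->
    N *m resolvent (N + M) eta = N *m resolvent N eta.
  move=> pN pM NM; have pNM := psdmxD pN pM.
  have NR : N *m resolvent N eta = resolvent N eta *m N.
    apply: (@addIr _ (eta *: resolvent N eta)).
    rewrite -{1}mul_scalar_mx -mulmxDl mulmx_resolvent //.
    by rewrite -mul_mx_scalar -mulmxDr mul_resolvent_mx.
  rewrite -[RHS]mulmx1 -(mulmx_resolvent pNM e0) mulmxA; congr (_ *m _).
  rewrite addrAC mulmxDr NR -[_ *m M]mulmxA NM mulmx0 addr0.
  by rewrite -NR -mulmxA mul_resolvent_mx // mulmx1.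
rewrite AA mulmxDl block //; last by rewrite mulmxA -[_ *m Y *m Y]mulmxA YY mulmx0 mul0mx.
rewrite [Y^T *m Y + _]addrC block //; last first.
  by rewrite mulmxA -[Y *m Y^T *m _]mulmxA YTYT mulmx0 mul0mx.
(* This intertwining, with cyclicity of the trace, identifies the two contributions. *)
have push : Y^T *m resolvent (Y *m Y^T) eta = resolvent (Y^T *m Y) eta *m Y^T.
  rewrite -[RHS]mulmx1 -(mulmx_resolvent pYT e0) mulmxA; congr (_ *m _).
  rewrite -mulmxA mulmxDr mulmxA mul_mx_scalar -mul_scalar_mx -mulmxDl mulmxA.
  by rewrite mul_resolvent_mx // mul1mx.
rewrite linearD /= -[Y *m Y^T *m _]mulmxA push [\tr (Y *m _)]mxtrace_mulC.
by rewrite -[resolvent _ _ *m Y^T *m Y]mulmxA [\tr (resolvent _ _ *m _)]mxtrace_mulC mulrDl mul1r.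
Qed.

(** At an index whose row in [N] is zero the resolvent has diagonal entry [eta^-1], so that index
    cancels from the left side. *)
Lemma trace_resolvent_supported (R : realFieldType) n (D : {set 'I_n}) (N : 'M[R]_n) eta :
  psdmx N -> 0 < eta -> (forall i j, i \notin D -> N i j = 0) ->
  n%:R - eta * \tr (resolvent N eta) = #|D|%:R - eta * ptrace D (resolvent N eta).
Proof.
move=> pN e0 ND; set G := resolvent N eta.
have diag i : i \notin D -> eta * G i i = 1.
  move=> iD; have := congr1 (fun M : 'M[R]_n => M i i) (mulmx_resolvent pN e0).
  rewrite mulmxDl mul_scalar_mx -/G !mxE big1 ?add0r ?eqxx // => j _.
  by rewrite ND // mul0r.
have -> : n%:R = #|D|%:R + \sum_(i < n | i \notin D) eta * G i i.
  rewrite (eq_bigr (fun=> 1) diag) sumr_const -natrD.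
  have -> : #|(fun i => i \notin D)| = #|~: D| by apply: eq_card => i; rewrite inE.
  by rewrite cardsC card_ord.
have -> : \tr G = ptrace D G + \sum_(i < n | i \notin D) G i i.
  by rewrite /mxtrace (bigID (mem D)).
by rewrite -mulr_sumr; ring.
Qed.

Lemma dotr_supported (R : comPzRingType) n (D : {set 'I_n}) (M : 'M[R]_n) (v : 'rV_n) :
  (forall j, j \notin D -> v 0 j = 0) ->
  dotr (v *m M) v = \sum_(i in D) \sum_(j in D) M i j * (v 0 i * v 0 j).
Proof.
move=> vD; rewrite /dotr [LHS](bigID (mem D)) /= [X in _ + X]big1 ?addr0 => [|j jD]; last first.
  by rewrite vD // mulr0.
rewrite [RHS]exchange_big /=; apply: eq_bigr => j jD.
rewrite mxE mulr_suml [LHS](bigID (mem D)) /= [X in _ + X]big1 ?addr0 => [|i iD]; last first.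
  by rewrite vD // !mul0r.
by apply: eq_bigr => i _; rewrite mulrAC mulrC.
Qed.

(** * Spectrum of a real symmetric matrix *)

Lemma conjugate_diag_mul (F : fieldType) n (P : 'M[F]_n) (d e : 'rV_n) : P \in unitmx ->
  (invmx P *m diag_mx d *m P) *m (invmx P *m diag_mx e *m P)
  = invmx P *m diag_mx (\row_i (d 0 i * e 0 i)) *m P.
Proof.
by move=> Pu; rewrite -!mulmxA (mulmxA P) mulmxV // mul1mx (mulmxA (diag_mx d)) mulmx_diag.
Qed.

Lemma conjugate_diag_shift (F : fieldType) n (P : 'M[F]_n) (d : 'rV_n) c : P \in unitmx ->
  invmx P *m diag_mx d *m P + c%:M = invmx P *m diag_mx (\row_i (d 0 i + c)) *m P.
Proof.
move=> Pu; have -> : c%:M = invmx P *m c%:M *m P.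
  by rewrite mul_mx_scalar -scalemxAl mulVmx // scalemx1.
rewrite -mulmxDl -mulmxDr; congr (_ *m _ *m _).
by apply/matrixP => i j; rewrite !mxE -mulrnDl.
Qed.

Lemma conjugate_diag_inv (F : fieldType) n (P : 'M[F]_n) (d e : 'rV_n) : P \in unitmx ->
  (forall i, d 0 i * e 0 i = 1) ->
  invmx (invmx P *m diag_mx d *m P) = invmx P *m diag_mx e *m P.
Proof.
move=> Pu de; have PP := conjugate_diag_mul d e Pu.
have dE : diag_mx (\row_i (d 0 i * e 0 i)) = 1%:M.
  by apply/matrixP => i j; rewrite !mxE de.
rewrite dE mulmx1 mulVmx // in PP.
have [u _] := mulmx1_unit PP.
by rewrite -[LHS]mulmx1 -PP mulmxA mulVmx // mul1mx.
Qed.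

Lemma mxtrace_conjugate (F : fieldType) n (P M : 'M[F]_n) : P \in unitmx ->
  \tr (invmx P *m M *m P) = \tr M.
Proof. by move=> Pu; rewrite mxtrace_mulC mulmxA mulmxV // mul1mx. Qed.

Lemma diagonalized_traces (F : fieldType) n (B P : 'M[F]_n) (d : 'rV_n) :
  P \in unitmx -> B = invmx P *m diag_mx d *m P ->
  [/\ char_poly B = \prod_i ('X - (d 0 i)%:P),
      \tr (B *m B) = \sum_i d 0 i ^+ 2
    & forall c, (forall i, d 0 i ^+ 2 + c != 0) ->
      \tr (invmx (B *m B + c%:M)) = \sum_i (d 0 i ^+ 2 + c)^-1].
Proof.
move=> Pu BE.
have BB : B *m B = invmx P *m diag_mx (\row_i (d 0 i * d 0 i)) *m P.
  by rewrite BE conjugate_diag_mul.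
split.
- rewrite /char_poly.
  have -> : char_poly_mx B =
      map_mx polyC (invmx P) *m char_poly_mx (diag_mx d) *m map_mx polyC P.
    rewrite /char_poly_mx BE !map_mxM mulmxBr mulmxBl /=; congr (_ - _).
    by rewrite mul_mx_scalar -scalemxAl -map_mxM mulVmx // map_mx1 scalemx1.
  rewrite !det_mulmx mulrAC -det_mulmx -map_mxM mulVmx // map_mx1 det1 mul1r.
  rewrite -/(char_poly _) char_poly_trig ?diag_mx_is_trig //.
  by apply: eq_bigr => i _; rewrite !mxE eqxx mulr1n.
- rewrite BB mxtrace_conjugate // mxtrace_diag.
  by apply: eq_bigr => i _; rewrite mxE.
- move=> c dc; rewrite BB conjugate_diag_shift //.
  rewrite (@conjugate_diag_inv _ _ _ _ (\row_i (d 0 i ^+ 2 + c)^-1)) //.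
    rewrite mxtrace_conjugate // mxtrace_diag.
    by apply: eq_bigr => i _; rewrite mxE.
  by move=> i; rewrite !mxE; apply: mulfV; apply: dc.
Qed.

(** The spectral theorem is used over [R[i]]; as the spectrum is real, each identity descends along
    the injection of [R]. *)
Lemma spectral_symmetric (R : realType) n (A : 'M[R]_n) :
  A^T = A -> exists r : 'I_n -> R,
  [/\ \sum_(z <- eigenvalues A) Normc.normc z = \sum_i `|r i|,
      \sum_i r i ^+ 2 = \tr (A *m A)
    & forall eta, 0 < eta ->
      \sum_i (r i ^+ 2 + eta)^-1 = \tr (invmx (A *m A + eta%:M))].
Proof.
move=> sA; pose f := real_complex R; pose B := map_mx f A.
have hB : B \is hermsymmx.
  apply: realsym_hermsym.
    apply/is_hermitianmxP; rewrite expr0 scale1r map_mx_id //.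
    by apply/matrixP => i j; rewrite !mxE -[in LHS]sA mxE.
  by apply/mxOverP => i j; rewrite mxE complex_real.
have /orthomx_spectralP BE := hermitian_normalmx hB.
have /mxOverP := hermitian_spectral_diag_real hB.
have [] := diagonalized_traces (spectral_unit B) BE.
move: (spectral_diag B) => d chB trB trI dr {BE}.
pose r i := complex.Re (d 0 i).
have dE i : d 0 i = f (r i) by rewrite /f /r RRe_real.
have fsum (F : 'I_n -> R) : f (\sum_i F i) = \sum_i f (F i) by rewrite /f rmorph_sum.
have ftr (M : 'M[R]_n) : f (\tr M) = \tr (map_mx f M).
  by apply/esym; exact: trace_map_mx.
have fBB : map_mx f (A *m A) = B *m B by rewrite map_mxM.
have finj : injective f by move=> a b [].
exists r; split.
- rewrite /eigenvalues -/f -/B; case: closed_field_poly_normal => s /= sE.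
  (* Two factorizations of the characteristic polynomial into linear factors agree up to order, so
     the root sequence chosen in [eigenvalues] permutes the spectral diagonal. *)
  have /prod_XsubC_eq : \prod_(x <- s) ('X - x%:P) =
      \prod_(x <- [seq d 0 i | i <- enum 'I_n]) ('X - x%:P).
    rewrite big_map big_enum /= -chB [RHS]sE.
    by rewrite (monicP (char_poly_monic _)) scale1r.
  move=> ps; rewrite (perm_big _ ps) big_map big_enum /=.
  by apply: eq_bigr => i _; rewrite dE /= expr0n /= addr0 sqrtr_sqr.
- apply: finj; rewrite fsum ftr fBB trB.
  by apply: eq_bigr => i _; rewrite dE /f rmorphXn.
- move=> eta eta0; apply: finj; rewrite fsum ftr map_invmx map_mxD fBB map_scalar_mx.
  have fE i : d 0 i ^+ 2 + f eta = f (r i ^+ 2 + eta) by rewrite dE /f rmorphD rmorphXn.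
  rewrite trI; last first.
    by move=> i; rewrite fE /f fmorph_eq0 gt_eqF // ltr_wpDl ?sqr_ge0.
  by apply: eq_bigr => i _; rewrite fE /f fmorphV.
Qed.

(** * Product Bernoulli measure *)

Definition bern (R : pzRingType) (p : R) (b : bool) : R := if b then p else 1 - p.

Definition weight (R : comPzRingType) (p : R) (E : finType) (w : {ffun E -> bool}) : R :=
  \prod_e bern p (w e).

Definition expect (R : comPzRingType) (p : R) (E : finType) (f : {ffun E -> bool} -> R) : R :=
  \sum_w weight p w * f w.

(** A functional form of independence from the coordinate [e]. *)
Definition ignores (E : finType) (T : Type) (e : E) (g : {ffun E -> bool} -> T) :=
  forall w w' : {ffun E -> bool}, (forall e', e' != e -> w e' = w' e') -> g w = g w'.

Lemma expectD (R : comPzRingType) (p : R) (E : finType) (f g : {ffun E -> bool} -> R) :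
  expect p (fun w => f w + g w) = expect p f + expect p g.
Proof. by rewrite /expect -big_split; apply: eq_bigr => w _; rewrite /= mulrDr. Qed.

Lemma expectZ (R : comPzRingType) (p c : R) (E : finType) (f : {ffun E -> bool} -> R) :
  expect p (fun w => c * f w) = c * expect p f.
Proof. by rewrite /expect mulr_sumr; apply: eq_bigr => w _; rewrite mulrCA. Qed.

Lemma expect_sum (R : comPzRingType) (p : R) (E I : finType) (P : pred I)
    (f : I -> {ffun E -> bool} -> R) :
  expect p (fun w => \sum_(i | P i) f i w) = \sum_(i | P i) expect p (f i).
Proof. by rewrite /expect exchange_big; apply: eq_bigr => w _; rewrite /= mulr_sumr. Qed.

Lemma eq_expect (R : comPzRingType) (p : R) (E : finType) (f g : {ffun E -> bool} -> R) :
  f =1 g -> expect p f = expect p g.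
Proof. by move=> fg; apply: eq_bigr => w _; rewrite fg. Qed.

Lemma expect_cst (R : comPzRingType) (p c : R) (E : finType) :
  expect p (fun _ : {ffun E -> bool} => c) = c.
Proof.
rewrite /expect -mulr_suml /weight -(bigA_distr_bigA (fun _ => bern p)) /=.
rewrite big1 ?mul1r // => e _.
by rewrite big_bool /bern /= addrC subrK.
Qed.

Lemma weight_ge0 (R : realDomainType) (p : R) (E : finType) (w : {ffun E -> bool}) :
  0 <= p <= 1 -> 0 <= weight p w.
Proof.
move=> /andP[p0 p1]; apply: prodr_ge0 => e _; rewrite /bern.
by case: (w e); rewrite ?subr_ge0.
Qed.

Lemma le_expect (R : realDomainType) (p : R) (E : finType) (f g : {ffun E -> bool} -> R) :
  0 <= p <= 1 -> (forall w, f w <= g w) -> expect p f <= expect p g.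
Proof.
by move=> p01 fg; apply: ler_sum => w _; rewrite ler_wpM2l ?weight_ge0.
Qed.

Lemma expect_ignores (R : comPzRingType) (p : R) (E : finType) (e : E)
    (g : {ffun E -> bool} -> R) (phi : bool -> R) :
  ignores e g ->
  expect p (fun w => g w * phi (w e)) = expect p g * (p * phi true + (1 - p) * phi false).
Proof.
move=> ig.
(* pair each [w] having [w e = true] with its flip at [e] *)
pose upd b (w : {ffun E -> bool}) : {ffun E -> bool} :=
  [ffun e' => if e' == e then b else w e'].
pose rest (w : {ffun E -> bool}) := \prod_(e' | e' != e) bern p (w e').
have split_coord (psi : bool -> R) : expect p (fun w => g w * psi (w e)) =
    (\sum_(w : {ffun E -> bool} | w e) rest w * g w) * (p * psi true + (1 - p) * psi false).
  have weightE w : weight p w = bern p (w e) * rest w by rewrite /weight (bigD1 e).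
  rewrite /expect (bigID (fun w : {ffun E -> bool} => w e)) /=.
  rewrite [X in _ + X](reindex_onto (upd false) (upd true)) /=; last first.
    move=> w /negbTE we; apply/ffunP => e'; rewrite !ffunE.
    by case: eqP => // ->; rewrite we.
  rewrite [X in _ + X](eq_bigl (fun w : {ffun E -> bool} => w e)); last first.
    move=> w; rewrite !ffunE eqxx /=; apply/eqP/idP => [<-|we].
      by rewrite !ffunE eqxx.
    by apply/ffunP => e'; rewrite !ffunE; case: eqP => // ->.
  rewrite mulrDr !mulr_suml -!big_split /=; apply: eq_bigr => w we.
  have gw : g (upd false w) = g w by apply: ig => e' /negbTE ne; rewrite ffunE ne.
  have rw : rest (upd false w) = rest w.
    by apply: eq_bigr => e' /negbTE ne; rewrite ffunE ne.
  by rewrite !weightE gw rw we ffunE eqxx /=; ring.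
rewrite split_coord; congr (_ * _).
(* The same formula with the constant test function 1 identifies the remaining sum as
   [expect p g]. *)
rewrite (eq_expect _ (g := fun w => g w * (fun=> 1) (w e))); last by move=> w; rewrite mulr1.
by rewrite (split_coord (fun=> 1)) !mulr1 [p + _]addrC subrK mulr1.
Qed.

Lemma expect_ignores0 (R : comPzRingType) (p : R) (E : finType) (e : E)
    (f g : {ffun E -> bool} -> R) (phi : bool -> R) :
  ignores e g -> (forall w, f w = g w * phi (w e)) ->
  p * phi true + (1 - p) * phi false = 0 -> expect p f = 0.
Proof. by move=> ig fE phi0; rewrite (eq_expect _ fE) expect_ignores // phi0 mulr0. Qed.

(** The deviation is the sum of [M i j * z i j] with [z i j = x i * x j - s2 [i = j]]. Two such
    terms are orthogonal unless their index pairs agree up to transposition, which leaves twice the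
    Frobenius norm. *)
Lemma expect_quadratic_form (R : realFieldType) (p : R) (E : finType) n (D : {set 'I_n})
    (idx : 'I_n -> E) (M : {ffun E -> bool} -> 'M[R]_n) (s2 := p * (1 - p))
    (x := fun i (w : {ffun E -> bool}) => (w (idx i))%:R - p) :
  0 <= p <= 1 -> {in D &, injective idx} ->
  (forall i, i \in D -> ignores (idx i) M) -> (forall w, (M w)^T = M w) ->
  expect p (fun w => (\sum_(i in D) \sum_(j in D) M w i j * (x i w * x j w)
                      - s2 * \sum_(i in D) M w i i) ^+ 2)
  <= 2 * expect p (fun w => \sum_i \sum_j M w i j ^+ 2).
Proof.
move=> p01 idxI igM sM.
pose z i j w := x i w * x j w - s2 * (i == j)%:R.
pose g (P : 'I_n * 'I_n) w := M w P.1 P.2 * z P.1 P.2 w.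
pose DD := [pred P : 'I_n * 'I_n | (P.1 \in D) && (P.2 \in D)].
have zC i j w : z i j w = z j i w by rewrite /z mulrC eq_sym.
have MC i j w : M w i j = M w j i by rewrite -[in LHS]sM mxE.
have sumE w : \sum_(i in D) \sum_(j in D) M w i j * (x i w * x j w)
    - s2 * \sum_(i in D) M w i i = \sum_(P in DD) g P w.
  rewrite -(pair_big (mem D) (mem D) (fun i j => g (i, j) w)) /= mulr_sumr -sumrB.
  apply: eq_bigr => i iD; rewrite (bigD1 i) //= [RHS](bigD1 i) //=.
  rewrite /g /z /= eqxx mulr1.
  rewrite [in RHS](eq_bigr (fun j => M w i j * (x i w * x j w))); first by ring.
  by move=> j /andP[_ /negbTE ji]; rewrite eq_sym ji mulr0 subr0.
have x_ig i s : i \in D -> s \in D -> i != s -> ignores (idx s) (x i).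
  move=> iD sD ne w w' ww'; rewrite /x ww' //.
  by apply: contra_neq ne => /idxI ->.
(* Integrate out the coordinate of [i], absent from the second pair: the factor that depends on it
   is [x i], or [x i ^+ 2 - s2] when [j = i], and both have mean zero. *)
have orth i j k l : i \in D -> j \in D -> k \in D -> l \in D ->
    i != k -> i != l -> expect p (fun w => g (i, j) w * g (k, l) w) = 0.
  move=> iD jD kD lD ik il; rewrite eq_sym in ik; rewrite eq_sym in il.
  have [ij|ij] := eqVneq j i.
    apply: (@expect_ignores0 _ _ _ (idx i) _ (fun w => M w i j * (M w k l * z k l w))
       (fun b => (b%:R - p) ^+ 2 - s2)).
    - move=> w w' ww'; rewrite /z (igM i iD w w') // (x_ig k i kD iD ik w w') //.
      by rewrite (x_ig l i lD iD il w w').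
    - by move=> w; rewrite /g /= {1}/z ij eqxx /x /=; ring.
    - by rewrite /s2 /= mulr1n mulr0n; ring.
  apply: (@expect_ignores0 _ _ _ (idx i) _
      (fun w => M w i j * x j w * (M w k l * z k l w)) (fun b : bool => b%:R - p : R)).
  - move=> w w' ww'; rewrite /z (igM i iD w w') // (x_ig k i kD iD ik w w') //.
    by rewrite (x_ig l i lD iD il w w') // (x_ig j i jD iD ij w w').
  - by move=> w; rewrite /g /= {1}/z eq_sym (negbTE ij) /x /=; ring.
  - by rewrite /= mulr1n mulr0n; ring.
have z_le1 i j w : z i j w ^+ 2 <= 1.
  have s2_01 : 0 <= s2 <= 1 by rewrite /s2; move: p01 => /andP[]; nra.
  have x_le1 k : -1 <= x k w <= 1.
    by rewrite /x; move: p01 => /andP[p0 p1]; case: (w _); rewrite /=; lra.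
  suff : -1 <= z i j w <= 1 by move=> /andP[]; nra.
  have [xi xj] := (x_le1 i, x_le1 j); move: s2_01 xi xj => /andP[s0 s1] /andP[a b] /andP[c d].
  by rewrite /z; case: eqVneq => [->|_] /=; rewrite ?mulr1 ?mulr0 ?subr0; apply/andP; split; nra.
have gsq P : expect p (fun w => g P w * g P w) <= expect p (fun w => M w P.1 P.2 ^+ 2).
  apply: le_expect => // w; rewrite /g.
  by have := z_le1 P.1 P.2 w; have := sqr_ge0 (M w P.1 P.2); nra.
have pair_le P Q : P \in DD -> Q \in DD -> expect p (fun w => g P w * g Q w)
    <= ((Q == P)%:R + (Q == (P.2, P.1))%:R) * expect p (fun w => M w P.1 P.2 ^+ 2).
  move: P Q => [i j] [k l] /=; rewrite !inE /= => /andP[iD jD] /andP[kD lD].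
  have E0 : 0 <= expect p (fun w => M w i j ^+ 2).
    by rewrite -(expect_cst p 0 E); apply: le_expect => // w; apply: sqr_ge0.
  have [[-> ->]|ne1] := eqVneq (k, l) (i, j).
    apply: le_trans (gsq (i, j)) _.
    by rewrite mulrDl mul1r lerDl mulr_ge0.
  have [[-> ->]|ne2] := eqVneq (k, l) (j, i).
    rewrite add0r mul1r (eq_expect _ (g := fun w => g (i, j) w * g (i, j) w)) ?gsq //.
    by move=> w; rewrite /g /= MC zC.
  rewrite addr0 mul0r le_eqVlt; apply/orP; left; apply/eqP.
  have swap a b c d : expect p (fun w => g (a, b) w * g (c, d) w) =
      expect p (fun w => g (b, a) w * g (c, d) w).
    by apply: eq_expect => w; rewrite /g /= MC zC.
  have sym P Q : expect p (fun w => g P w * g Q w) = expect p (fun w => g Q w * g P w).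
    by apply: eq_expect => w; rewrite mulrC.
  (* As the pairs differ even up to transposition, some index occurs in only one of them; [swap] and
     [sym] move it to the position of [i] in [orth]. *)
  have [ik|ik] := eqVneq i k; have [il|il] := eqVneq i l; last by rewrite orth.
  - have [jk|jk] := eqVneq j k; first by move: ne1; rewrite jk -il ik eqxx.
    by rewrite swap orth // -il ik.
  - have jl : j != l by apply: contra_neq ne1 => ->; rewrite ik.
    have [jk|jk] := eqVneq j k; last by rewrite swap orth.
    by rewrite sym swap orth // eq_sym.
  - have jk : j != k by apply: contra_neq ne2 => ->; rewrite il.
    have [jl|jl] := eqVneq j l; last by rewrite swap orth.
    by rewrite sym orth // eq_sym.
rewrite (eq_expect _ (g := fun w => \sum_(P in DD) \sum_(Q in DD) g P w * g Q w)); last first.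
  by move=> w; rewrite sumE expr2 mulr_suml; apply: eq_bigr => P _; rewrite mulr_sumr.
have count_le1 P : (\sum_(Q in DD) (Q == P) <= 1)%N.
  apply: (@leq_trans (\sum_Q (Q == P))%N).
    by rewrite [leqRHS](bigID (mem DD)) leq_addr.
  by rewrite (bigD1 P) //= eqxx big1 // => Q /negbTE ->.
rewrite expect_sum; under eq_bigr => P _ do rewrite expect_sum.
apply: (@le_trans _ _ (\sum_(P in DD) 2 * expect p (fun w => M w P.1 P.2 ^+ 2))).
  apply: ler_sum => P PD.
  apply: le_trans (ler_sum _ (fun Q QD => pair_le P Q PD QD)) _.
  rewrite -mulr_suml big_split /= -!natr_sum ler_wpM2r //.
    by rewrite -(expect_cst p 0 E); apply: le_expect => // w; apply: sqr_ge0.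
  by rewrite -natrD ler_nat (leq_add (count_le1 _) (count_le1 _)).
rewrite -mulr_sumr ler_pM2l // -expect_sum; apply: le_expect => // w.
rewrite -(pair_big (mem D) (mem D) (fun i j => M w i j ^+ 2)) /=.
apply: (@le_trans _ _ (\sum_(i in D) \sum_j M w i j ^+ 2)).
  apply: ler_sum => i _; rewrite [leRHS](bigID (mem D)) /= lerDl.
  by apply: sumr_ge0 => *; apply: sqr_ge0.
rewrite [leRHS](bigID (mem D)) /= lerDl.
by apply: sumr_ge0 => *; apply: sumr_ge0 => *; apply: sqr_ge0.
Qed.

(** * Approximate self-consistent equation *)

Lemma le_frac_dist (R : realFieldType) (a b : R) : 0 <= a -> 0 <= b ->
  `|a / (1 + a) - b / (1 + b)| <= `|a - b|.
Proof.
move=> a0 b0.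
have a1 : 0 < 1 + a by rewrite ltr_pwDl.
have b1 : 0 < 1 + b by rewrite ltr_pwDl.
have -> : a / (1 + a) - b / (1 + b) = (a - b) / ((1 + a) * (1 + b)).
  by field; rewrite !gt_eqF.
rewrite normrM ler_piMr // normfV invf_le1 ?normr_gt0 ?gt_eqF ?mulr_gt0 //.
by rewrite ger0_norm; nra.
Qed.

Definition centred_row (R : pzRingType) (p : R) n (D : {set 'I_n})
    (w : {ffun {set 'I_n} -> bool}) (k : 'I_n) : 'rV[R]_n :=
  \row_j (if j \in D then (w [set k; j]%SET)%:R - p else 0).

(** In the exact identity, [q_k] is replaced by [s2 tau]. Per row this costs the fluctuation of
    [q_k] around [s2 tau_k], bounded in mean square, and [eta^-1] for restoring the removed row. The
    parameter [delta] stays free to balance the terms. *)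
Lemma expect_self_consistent (R : realFieldType) (p : R) n (V1 V2 : {set 'I_n}) eta delta
    (tau := fun w => ptrace V2 (resolvent (gram V1 (centred_row p V2 w)) eta))
    (s2 := p * (1 - p)) :
  0 <= p <= 1 -> [disjoint V1 & V2] -> 0 < eta -> 0 < delta ->
  expect p (fun w => `|#|V1|%:R * (s2 * tau w / (1 + s2 * tau w)) + eta * tau w - #|V2|%:R|)
  <= #|V1|%:R * (delta + 2 * n%:R / eta ^+ 2 / delta + eta^-1).
Proof.
move=> p01 dV e0 d0.
have V12 i j : i \in V1 -> j \in V2 -> i != j.
  by move=> iV1 jV2; apply: contraTneq jV2 => <-; rewrite (disjointFr dV).
pose x w k := centred_row p V2 w k.
pose Rk k w := resolvent (gram (V1 :\ k) (x w)) eta.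
pose q k w := dotr (x w k *m Rk k w) (x w k).
pose tk k w := ptrace V2 (Rk k w).
have s2_01 : 0 <= s2 <= 1 by rewrite /s2; move: p01 => /andP[]; nra.
have tau0 w : 0 <= tau w by apply: ptrace_resolvent_ge0 => //; apply: psdmx_gram.
have q0 k w : 0 <= q k w.
  apply: le_trans (resolvent_dot_ge _ (psdmx_gram _ _) e0).
  by rewrite mulr_ge0 ?dotr_ge0 // ltW.
have var k : k \in V1 -> expect p (fun w => (q k w - s2 * tk k w) ^+ 2)
    <= 2 * (n%:R / eta ^+ 2).
  move=> kV1; pose idx (j : 'I_n) := [set k; j]%SET.
  have -> : expect p (fun w => (q k w - s2 * tk k w) ^+ 2) =
    expect p (fun w => (\sum_(i in V2) \sum_(j in V2) Rk k w i j *
       (((w (idx i))%:R - p) * ((w (idx j))%:R - p))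
                      - s2 * \sum_(i in V2) Rk k w i i) ^+ 2).
    apply: eq_expect => w; congr ((_ - _) ^+ 2).
    rewrite /q (dotr_supported (D := V2)); last by move=> j jV2; rewrite mxE (negbTE jV2).
    apply: eq_bigr => i iV2; apply: eq_bigr => j jV2.
    by rewrite !mxE iV2 jV2.
  apply: le_trans (expect_quadratic_form p01 _ _ _) _.
  - move=> i j iV2 jV2 /= ij; have : i \in [set k; j]%SET by rewrite -[[set k; j]]ij set22.
    by rewrite !inE eq_sym (negbTE (V12 _ _ kV1 iV2)) => /eqP.
  (* The rows other than [k] never read the pair [[set k; i]], since [k] and [l] lie in [V1] and [i]
     in [V2]. *)
  - move=> i iV2 w w' ww'; congr (resolvent _ _); apply: eq_bigr => l.
    rewrite in_setD1 => /andP[lk lV1].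
    suff -> : x w l = x w' l by [].
    apply/rowP => j; rewrite !mxE; case: ifP => // jV2.
    rewrite ww' //; apply: contra_neq lk => lj.
    have : l \in idx i by rewrite -lj set21.
    by rewrite /idx !inE (negbTE (V12 _ _ lV1 iV2)) orbF => /eqP.
  - by move=> w; rewrite trmx_resolvent //; apply: psdmx_gram.
  rewrite ler_pM2l // -[leRHS](expect_cst p _ {set 'I_n}).
  by apply: le_expect => // w; apply: resolvent_frobenius => //; apply: psdmx_gram.
have pointwise w :
  `|#|V1|%:R * (s2 * tau w / (1 + s2 * tau w)) + eta * tau w - #|V2|%:R| <=
  \sum_(k in V1) (delta + eta^-1 + delta^-1 * (q k w - s2 * tk k w) ^+ 2).
  rewrite -(self_consistent_eq V1 (D := V2) (x := x w) e0); last first.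
    by move=> k j jV2; rewrite mxE (negbTE jV2).
  rewrite opprD addrACA subrr addr0 mulr_natl -sumr_const -sumrB.
  apply: le_trans (ler_norm_sum _ _ _) _; apply: ler_sum => k kV1.
  apply: le_trans (le_frac_dist _ (q0 k w)) _; first by rewrite mulr_ge0 //; case/andP: s2_01.
  have := ptrace_rank1 V2 (x w k) (psdmx_gram (V1 :\ k) (x w)) e0.
  have <- : gram V1 (x w) = gram (V1 :\ k) (x w) + (x w k)^T *m x w k.
    by rewrite /gram (big_setD1 k kV1) /= addrC.
  rewrite -/(tk k w) -/(tau w) -/(q k w) => tt.
  set u := q k w - s2 * tk k w.
  (* This bounds the first absolute moment by the second without a square root. *)
  have su : `|u| <= delta + delta^-1 * u ^+ 2.
    have : 0 <= (`|u| - delta) ^+ 2 by apply: sqr_ge0.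
    rewrite sqrrB real_normK ?num_real // => h.
    rewrite -(ler_pM2l d0) mulrDr mulVKf ?gt_eqF //.
    have := normr_ge0 u; nra.
  have : `|s2 * tau w - q k w| <= `|u| + eta^-1.
    have -> : s2 * tau w - q k w = - u - s2 * (tk k w - tau w) by rewrite /u; ring.
    apply: le_trans (ler_normB _ _) _; rewrite normrN lerD2l ger0_norm.
      by move: s2_01 tt => /andP[? ?] /andP[? ?]; nra.
    by move: s2_01 tt => /andP[? ?] /andP[? ?]; nra.
  lra.
apply: le_trans (le_expect p01 pointwise) _.
rewrite expect_sum mulr_natl -sumr_const; apply: ler_sum => k kV1.
rewrite expectD expect_cst expectZ -!addrA lerD2l addrC lerD2r mulrC.
by rewrite ler_pM2r ?invr_gt0 // -mulrA; apply: var.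
Qed.

(** * Sampling the random bipartite graph *)

Lemma sampled_edges_card2 n (V1 V2 : {set 'I_n}) (w : {ffun {set 'I_n} -> bool}) :
  [forall e in [set e in cross_edges V1 V2 | w e && (#|e| == 2)]%SET, #|e| == 2].
Proof. by apply/forall_inP => e; rewrite inE => /and3P[]. Qed.

(** A bit is drawn for every vertex set, which keeps the index type of the product measure simple;
    the cardinality test makes this a graph for arbitrary [V1] and [V2]. *)
Definition sampled_graph n (V1 V2 : {set 'I_n}) (w : {ffun {set 'I_n} -> bool}) : sgraph n :=
  SGraph (sampled_edges_card2 V1 V2 w).

Lemma cross_edgesP n (V1 V2 : {set 'I_n}) e :
  reflect (exists u v, [/\ u \in V1, v \in V2 & e = [set u; v]%SET]) (e \in cross_edges V1 V2).
Proof.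
apply: (iffP finset.bigcupP) => [[u uV1 /finset.bigcupP[v vV2]]|[u [v [uV1 vV2 ->]]]].
  by rewrite inE => /eqP ->; exists u, v.
by exists u => //; apply/finset.bigcupP; exists v => //; rewrite inE.
Qed.

Lemma cross_edges_card2 n (V1 V2 : {set 'I_n}) e : [disjoint V1 & V2] ->
  e \in cross_edges V1 V2 -> #|e| == 2.
Proof.
move=> dV /cross_edgesP[u [v [uV1 vV2 ->]]]; rewrite cards2 eqSS eqb1.
by apply: contraTneq vV2 => <-; rewrite (disjointFr dV).
Qed.

Lemma cross_edges_pair n (V1 V2 : {set 'I_n}) i j : [disjoint V1 & V2] ->
  ([set i; j]%SET \in cross_edges V1 V2)
  = (i \in V1) && (j \in V2) || (j \in V1) && (i \in V2).
Proof.
move=> dV; apply/cross_edgesP/orP => [[u [v [uV1 vV2 E]]]|[] /andP[a b]]; last 2 first.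
- by exists i, j.
- by exists j, i; split => //; rewrite finset.setUC.
have : u \in [set i; j]%SET by rewrite E set21.
have : v \in [set i; j]%SET by rewrite E set22.
have uv : u != v by apply: contraTneq vV2 => <-; rewrite (disjointFr dV).
rewrite !inE => /orP[] /eqP vE /orP[] /eqP uE; subst; rewrite ?eqxx // in uv.
- by right; rewrite uV1.
- by left; rewrite uV1.
Qed.

(** The fibre over [G] prescribes the bits on the cross edges and leaves the others free. Its weight
    is therefore a product, in which each free bit contributes [p + (1 - p) = 1]. *)
Lemma expect_sampled_graph (R : realType) (p : R) n (V1 V2 : {set 'I_n}) (f : sgraph n -> R) :
  [disjoint V1 & V2] ->
  \sum_G bipartite_mass p V1 V2 G * f G = expect p (fun w => f (sampled_graph V1 V2 w)).
Proof.
move=> dV; rewrite /expect (partition_big (sampled_graph V1 V2) xpredT) //=.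
apply: eq_bigr => G _.
rewrite (eq_bigr (fun w => weight p w * f G)); last by move=> w /eqP ->.
rewrite -mulr_suml; congr (_ * _).
have edgesE w : edges (sampled_graph V1 V2 w) = [set e in cross_edges V1 V2 | w e]%SET.
  apply/setP => e; rewrite !inE; case: (boolP (e \in _)) => //= eC.
  by rewrite (cross_edges_card2 dV eC) andbT.
rewrite /bipartite_mass; case: ifPn => [sub|nsub]; last first.
  rewrite big1 // => w /eqP wG; case/negP: nsub; rewrite -wG edgesE.
  by apply/fintype.subsetP => e; rewrite inE => /andP[].
pose Q e b := (e \in cross_edges V1 V2) ==> (b == (e \in edges G)).
rewrite (eq_bigl (mem (family Q))); last first.
  move=> w; apply/eqP/familyP => [wG e|wQ].
    by rewrite unfold_in /Q -wG edgesE inE; apply/implyP => ->.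
  apply: val_inj; change (edges (sampled_graph V1 V2 w) = edges G).
  rewrite edgesE; apply/setP => e; rewrite finset.in_set.
  have : Q e (w e) := wQ e.
  rewrite /Q; case: (boolP (e \in cross_edges V1 V2)) => [eC /= /eqP //|eC _ /=].
  by apply/esym/negbTE; apply: contra eC => /(fintype.subsetP sub).
rewrite /weight -(bigA_distr_big_dep Q (fun _ => bern p)) [in LHS]big_mkcond /=.
apply: eq_bigr => e _; rewrite /Q; case: ifP => eC /=.
  by rewrite big_pred1_eq.
by rewrite big_bool /bern /= addrC subrK.
Qed.

Lemma bipartite_probE (R : realType) (p : R) n (V1 V2 : {set 'I_n}) (Q : pred (sgraph n)) :
  [disjoint V1 & V2] ->
  bipartite_prob p V1 V2 Q = expect p (fun w => (Q (sampled_graph V1 V2 w))%:R).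
Proof.
move=> dV; rewrite -(expect_sampled_graph _ (fun G => (Q G)%:R)) // /bipartite_prob big_mkcond.
by apply: eq_bigr => G _; case: (Q G); rewrite ?mulr1 ?mulr0.
Qed.

Lemma bipartite_prob_le1 (R : realType) (p : R) n (V1 V2 : {set 'I_n}) (Q : pred (sgraph n)) :
  0 <= p <= 1 -> [disjoint V1 & V2] -> bipartite_prob p V1 V2 Q <= 1.
Proof.
move=> p01 dV; rewrite bipartite_probE // -[leRHS](expect_cst p _ {set 'I_n}).
by apply: le_expect => // w; case: (Q _).
Qed.

(** Markov's inequality: [F] dominates the indicator of the failure of [Q]. *)
Lemma bipartite_prob_ge (R : realType) (p : R) n (V1 V2 : {set 'I_n}) (Q : pred (sgraph n))
    (F : {ffun {set 'I_n} -> bool} -> R) :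
  0 <= p <= 1 -> [disjoint V1 & V2] -> (forall w, 0 <= F w) ->
  (forall w, ~~ Q (sampled_graph V1 V2 w) -> 1 <= F w) ->
  1 - expect p F <= bipartite_prob p V1 V2 Q.
Proof.
move=> p01 dV F0 FQ; rewrite bipartite_probE // lerBlDr.
rewrite -expectD -[leLHS](expect_cst p _ {set 'I_n}).
apply: le_expect => // w; have := FQ w; have := F0 w.
by case: (Q _) => /= [|_ /(_ isT)]; rewrite ?lerDl ?add0r.
Qed.

(** The biadjacency matrix padded to size [n]; for disjoint parts the orientation from [V1] to [V2]
    makes its square zero. *)
Definition bipartite_mx (R : pzRingType) n (V1 V2 : {set 'I_n})
    (w : {ffun {set 'I_n} -> bool}) : 'M[R]_n :=
  \matrix_(i, j) (if (i \in V1) && (j \in V2) then (w [set i; j]%SET)%:R else 0).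

Lemma adjacency_sampled (R : realType) n (V1 V2 : {set 'I_n}) w : [disjoint V1 & V2] ->
  adjacency R (sampled_graph V1 V2 w) = bipartite_mx R V1 V2 w + (bipartite_mx R V1 V2 w)^T.
Proof.
move=> dV; apply/matrixP => i j; rewrite !mxE inE.
case: (boolP ([set i; j]%SET \in cross_edges V1 V2)) => [/[dup] eC|].
  move=> /(cross_edges_card2 dV) ->; rewrite andbT /=.
  move: eC; rewrite cross_edges_pair // => /orP[] /andP[a b]; rewrite a b /=.
    by rewrite (disjointFl dV b) addr0.
  by rewrite (disjointFl dV b) add0r finset.setUC.
by rewrite cross_edges_pair // negb_or => /andP[/negbTE -> /negbTE ->] /=; rewrite addr0.
Qed.

(** The sum in [r] is [n - eta tr (A^2 + eta)^-1], which the bipartite structure reduces to a trace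
    over [V2]. Centring moves that trace by at most [eta^-1], so after the factor [2 * eta] the
    error is 2 for every [eta]. *)
Lemma sampled_graph_spectrum (R : realType) (p : R) n (V1 V2 : {set 'I_n}) w :
  [disjoint V1 & V2] -> (0 < #|V1|)%N ->
  exists r : 'I_n -> R,
  [/\ energy R (sampled_graph V1 V2 w) = \sum_i `|r i|,
      \sum_i r i ^+ 2 <= n%:R ^+ 2
    & forall eta, 0 < eta ->
      `|\sum_i r i ^+ 2 / (r i ^+ 2 + eta) - 2 * (#|V2|%:R -
         eta * ptrace V2 (resolvent (gram V1 (centred_row p V2 w)) eta))| <= 2].
Proof.
move=> dV V10; set A := adjacency R (sampled_graph V1 V2 w).
pose Y := bipartite_mx R V1 V2 w.
have AE : A = Y + Y^T by apply: adjacency_sampled.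
have sA : A^T = A by rewrite AE linearD /= trmxK addrC.
have YY : Y *m Y = 0.
  apply/matrixP => i j; rewrite !mxE big1 // => k _; rewrite !mxE.
  case: ifP => [/andP[_ kV2]|_]; last by rewrite mul0r.
  by rewrite (disjointFl dV kV2) mulr0.
have [r [rE r2 rR]] := spectral_symmetric sA.
exists r; split => //.
  rewrite r2 /mxtrace.
  have -> : n%:R ^+ 2 = \sum_(i < n) \sum_(j < n) (1 : R).
    by rewrite !sumr_const !card_ord -natrX -mulrnA mulnn.
  apply: ler_sum => i _; rewrite mxE; apply: ler_sum => j _; rewrite !mxE.
  by rewrite -natrM (ler_nat _ _ 1); case: (_ \in _); case: (_ \in _).
move=> eta e0.
have -> : \sum_i r i ^+ 2 / (r i ^+ 2 + eta) = n%:R - eta * \tr (resolvent (A *m A) eta).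
  rewrite -rR // mulr_sumr.
  have -> : n%:R = \sum_(i < n) (1 : R) by rewrite sumr_const card_ord.
  rewrite -sumrB; apply: eq_bigr => i _; field.
  by rewrite gt_eqF // ltr_wpDl ?sqr_ge0.
rewrite AE trace_bipartite //.
rewrite (@trace_resolvent_supported _ _ V2 (Y^T *m Y)) //; last 2 first.
- exact: psdmx_mulT.
- move=> i j iV2; rewrite mxE big1 // => k _; rewrite !mxE (negbTE iV2) andbF mul0r //.
have -> : Y^T *m Y = gram V1 (fun k => centred_row p V2 w k + p *: \row_j (j \in V2)%:R).
  apply/matrixP => i j; rewrite mxE summxE (bigID (mem V1)) /= [X in _ + X]big1 ?addr0 => [|k kV1].
    apply: eq_bigr => k kV1; rewrite !mxE big_ord1 !mxE kV1 /=.
    by case: (i \in V2); case: (j \in V2); rewrite /= ?mulr1 ?mulr0 ?subrK ?addr0 ?mul0r ?mulr0.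
  by rewrite !mxE (negbTE kV1) mul0r.
have := ptrace_translation V2 (centred_row p V2 w) (p *: \row_j (j \in V2)%:R) V10 e0.
set a := ptrace _ _; set b := ptrace _ _ => ab.
have -> : 2 * (#|V2|%:R - eta * a) - 2 * (#|V2|%:R - eta * b) = - (2 * eta * (a - b)) by ring.
rewrite normrN normrM ger0_norm ?mulr_ge0 ?(ltW e0) // -mulrA -[leRHS]mulr1 ler_pM2l //.
by rewrite mulrC -ler_pdivlMr // div1r.
Qed.

(** * Coulson sums and the limiting equation *)

(** Clearing denominators gives [e T^2 + (1 + e - y) T - y = 0]; [T] is its nonnegative root and [S]
    the square root of the discriminant. *)
Lemma fixpoint_solution (R : rcfType) (y e : R)
    (S := Num.sqrt ((1 + y + e) ^+ 2 - 4 * y)) (T := (y - 1 - e + S) / (2 * e)) :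
  0 < y -> 0 < e -> 0 <= T /\ T / (1 + T) + e * T = y.
Proof.
move=> y0 e0.
have dE : (1 + y + e) ^+ 2 - 4 * y = (1 + e - y) ^+ 2 + 4 * e * y by ring.
have ey0 : 0 < e * y by rewrite mulr_gt0.
have d0 : 0 <= (1 + y + e) ^+ 2 - 4 * y.
  by rewrite dE addr_ge0 ?sqr_ge0 // -mulrA mulr_ge0 // ltW.
have S2 : S ^+ 2 = (1 + y + e) ^+ 2 - 4 * y by rewrite sqr_sqrtr.
have S0 : 0 <= S by apply: sqrtr_ge0.
have T0 : 0 <= T.
  have : 1 + e - y <= S.
    apply: le_trans (ler_norm _) _; rewrite -sqrtr_sqr ler_sqrt // dE lerDl.
    by rewrite -mulrA mulr_ge0 // ltW.
  by move=> ?; rewrite divr_ge0 //; lra.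
split => //.
have ST : S = 2 * e * T - y + 1 + e by rewrite /T; field; rewrite gt_eqF.
have T1 : 1 + T != 0 by rewrite gt_eqF // ltr_pwDl.
apply: (mulIf T1); rewrite mulrDl divfK //.
have : 4 * e * (T + e * T * (1 + T) - y * (1 + T)) = 0.
  apply: (@etrans _ _ (S ^+ 2 - ((1 + y + e) ^+ 2 - 4 * y))); last by rewrite S2 subrr.
  by rewrite ST; ring.
move=> /eqP; rewrite !mulf_eq0 pnatr_eq0 /= gt_eqF //= subr_eq0 => /eqP //.
Qed.

(** The terms [l1 * f (s2 * t)] and [eta * t] both increase with [t], so their differences have the
    same sign and the second is bounded by the sum. Exchanging [n1] for [l1] costs at most
    [|n1 - l1|] because [f] lies in [[0, 1]]. *)
Lemma fixpoint_stable (R : realFieldType) (n1 n2 l1 l2 s2 eta t u : R)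
    (f := fun q : R => q / (1 + q)) :
  0 <= s2 -> 0 < eta -> 0 <= l1 -> 0 <= t -> 0 <= u ->
  l1 * f (s2 * u) + eta * u = l2 ->
  `|eta * t - eta * u| <=
    `|n1 * f (s2 * t) + eta * t - n2| + `|n1 - l1| + `|n2 - l2|.
Proof.
move=> s0 e0 l0 t0 u0 ul.
have fE q : 0 <= q -> f q = 1 - (1 + q)^-1.
  by move=> q0; rewrite /f; field; rewrite gt_eqF // ltr_pwDl.
have f01 q : 0 <= q -> 0 <= f q <= 1.
  move=> q0; rewrite divr_ge0 ?addr_ge0 //= fE //.
  by rewrite gerBl invr_ge0 addr_ge0.
have fle a b : 0 <= a -> a <= b -> f a <= f b.
  move=> a0 ab; rewrite !fE // ?(le_trans a0) // lerD2l lerN2 lef_pV2 ?posrE; lra.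
have st : 0 <= s2 * t by rewrite mulr_ge0.
have su : 0 <= s2 * u by rewrite mulr_ge0.
have := f01 _ st => /andP[ft0 ft1].
have h : `|l1 * f (s2 * t) + eta * t - l2| <=
    `|n1 * f (s2 * t) + eta * t - n2| + `|n1 - l1| + `|n2 - l2|.
  have -> : l1 * f (s2 * t) + eta * t - l2 =
    (n1 * f (s2 * t) + eta * t - n2) - (n1 - l1) * f (s2 * t) + (n2 - l2) by ring.
  apply: le_trans (ler_normD _ _) _; rewrite lerD2r.
  apply: le_trans (ler_normB _ _) _; rewrite lerD2l normrM (ger0_norm ft0).
  by rewrite ler_piMr.
apply: le_trans h; rewrite -ul.
have -> : l1 * f (s2 * t) + eta * t - (l1 * f (s2 * u) + eta * u) =
  l1 * (f (s2 * t) - f (s2 * u)) + (eta * t - eta * u) by ring.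
have [tu|ut] := leP t u.
  have := fle _ _ st (ler_wpM2l s0 tu) => ff.
  have : l1 * (f (s2 * t) - f (s2 * u)) <= 0 by rewrite mulr_ge0_le0 // subr_le0.
  have : eta * t - eta * u <= 0 by rewrite subr_le0 ler_pM2l.
  move=> a b; rewrite !ler0_norm //; lra.
have := fle _ _ su (ler_wpM2l s0 (ltW ut)) => ff.
have : 0 <= l1 * (f (s2 * t) - f (s2 * u)) by rewrite mulr_ge0 // subr_ge0.
have : 0 <= eta * t - eta * u by rewrite subr_ge0 ler_pM2l // ltW.
move=> a b; rewrite !ger0_norm //; lra.
Qed.

Lemma atan_inv (R : realType) (x : R) : 0 < x -> atan x + atan x^-1 = pi / 2.
Proof.
move=> x0; have t0 : 0 < atan x by rewrite -atan0 lt_atan.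
have tpi := atan_ltpi2 x.
have c0 : 0 < cos (atan x) by apply: cos_gt0_pihalf; rewrite atan_gtNpi2.
have xE : x^-1 = tan (pi / 2 - atan x).
  rewrite /tan [sin _](_ : _ = cos (atan x)); last by rewrite sinB sin_pihalf cos_pihalf; ring.
  rewrite [cos (_ - _)](_ : _ = sin (atan x)); last by rewrite cosB sin_pihalf cos_pihalf; ring.
  by rewrite -[in LHS](atanK x) /tan invf_div.
rewrite xE tanK; first by rewrite addrC subrK.
by rewrite in_itv /=; apply/andP; split; have := pi_gt0 R; lra.
Qed.

Lemma atan_le (R : realType) (x : R) : 0 < x -> atan x <= x.
Proof.
move=> x0.
have cF : {within `[0, x], continuous (@atan R)}%classic.
  by apply: derivable_within_continuous => z _; apply: ex_derive.
have [c _] := MVT x0 (fun z _ => is_derive1_atan z) cF.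
rewrite atan0 !subr0 => ->; rewrite ler_piMl ?(ltW x0) // invf_le1 ?lerDl ?sqr_ge0 //.
by rewrite ltr_wpDr ?sqr_ge0.
Qed.

(** A right-endpoint Riemann sum of the decreasing function [s^2 / (s^2 + t^2)], with primitive
    [s atan (t / s)], stays below [s pi / 2]. What is lost is at most one cell, of size [h], and the
    tail [s atan (s / (N h))]. *)
Lemma coulson_sum (R : realType) (s h : R) N : 0 <= s -> 0 < h -> (0 < N)%N ->
  0 <= s - 2 / pi * (h * \sum_(j < N) s ^+ 2 / (s ^+ 2 + (j.+1%:R * h) ^+ 2))
    <= 2 / pi * (h + s ^+ 2 / (N%:R * h)).
Proof.
rewrite le_eqVlt => /predU1P[<-|s0] h0 N0.
  rewrite big1 => [|j _]; last by rewrite expr0n /= mul0r.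
  rewrite expr0n /= mulr0 mulr0 subrr lexx mul0r addr0.
  by rewrite mulr_ge0 ?(ltW h0) // divr_ge0 // pi_ge0.
pose F (t : R) := s * atan (t / s).
pose g (t : R) := s ^+ 2 / (s ^+ 2 + t ^+ 2).
have pi0 := pi_gt0 R.
have den0 (t : R) : 0 < s ^+ 2 + t ^+ 2 by rewrite ltr_wpDr ?sqr_ge0 ?exprn_gt0.
have dF (t : R) : is_derive t 1 F (g t).
  have -> : g t = s *: ((1 + (t / s) ^+ 2)^-1 * s^-1).
    rewrite /g -[RHS]/(s * _); field; apply/andP; split; rewrite gt_eqF //.
  have dts : is_derive t 1 (fun t : R => t / s) s^-1.
    apply: (is_derive_eq (is_deriveM (is_derive_id t 1) (is_derive_cst s^-1 t 1))).
    by rewrite scaler0 add0r; exact: mulr1.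
  apply: is_deriveZ; exact: (is_derive1_comp (f := @atan R)).
have gle (a b : R) : 0 <= a -> a <= b -> g b <= g a.
  move=> a0 ab; rewrite ler_pM2l ?exprn_gt0 // lef_pV2 ?posrE ?den0 // lerD2l.
  by rewrite lerXn2r ?nnegrE // (le_trans a0).
have step (a b : R) : 0 <= a -> a < b -> g b * (b - a) <= F b - F a <= g a * (b - a).
  move=> a0 ab.
  have cF : {within `[a, b], continuous F}%classic.
    by apply: derivable_within_continuous => z _; apply: ex_derive.
  have [c] := MVT ab (fun x _ => dF x) cF.
  rewrite in_itv /= => /andP[ac cb] ->; have ba : 0 < b - a by rewrite subr_gt0.
  rewrite !ler_pM2r //; apply/andP; split; apply: gle; rewrite ?(ltW ac) ?(ltW cb) //.
  by rewrite (le_trans a0) // ltW.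
pose t_ (j : nat) := j%:R * h.
have tS j : t_ j.+1 - t_ j = h by rewrite /t_ -natr1; ring.
have t0 j : 0 <= t_ j by rewrite mulr_ge0 // ltW.
have tlt j : t_ j < t_ j.+1 by rewrite -subr_gt0 tS.
have F0 : F (t_ 0) = 0 by rewrite /F /t_ mul0r mul0r atan0 mulr0.
have sumF M : F (t_ M) = \sum_(j < M) (F (t_ j.+1) - F (t_ j)).
  elim: M => [|M IH]; first by rewrite big_ord0.
  by rewrite big_ord_recr /= -IH; ring.
have up : h * \sum_(j < N) g (t_ j.+1) <= F (t_ N).
  rewrite sumF mulr_sumr; apply: ler_sum => j _.
  by have /andP[+ _] := step _ _ (t0 j) (tlt j); rewrite tS mulrC.
(* Read as left endpoints, the same nodes cover the cells from [t_ 1] to [t_ N.+1]; the missing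
   first cell costs at most [h] since [g <= 1]. *)
have lo : F (t_ N.+1) - h <= h * \sum_(j < N) g (t_ j.+1).
  rewrite sumF big_ord_recl /= lerBlDr mulr_sumr addrC; apply: lerD.
    apply: ler_sum => j _; have /andP[_] := step _ _ (t0 j.+1) (tlt j.+1).
    by rewrite /bump /= !add1n tS mulrC.
  have /andP[_] := step _ _ (t0 0%N) (tlt 0%N); rewrite tS => /le_trans; apply.
  by rewrite ler_piMl ?(ltW h0) // ler_pdivrMr ?den0 // mul1r lerDl sqr_ge0.
have tN0 M : (0 < M)%N -> 0 < t_ M by move=> M0; rewrite mulr_gt0 // ltr0n.
have Flt : F (t_ N) <= s * (pi / 2) by rewrite ler_pM2l // ltW // atan_ltpi2.
have Fge : s * (pi / 2) - s ^+ 2 / t_ N <= F (t_ N.+1).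
  have := step _ _ (t0 N) (tlt N) => /andP[+ _]; have := den0 (t_ N.+1) => d1.
  have : 0 <= g (t_ N.+1) * (t_ N.+1 - t_ N).
    by rewrite tS mulr_ge0 ?(ltW h0) // divr_ge0 ?sqr_ge0 // ltW.
  move=> p1 p2; apply: (@le_trans _ _ (F (t_ N))); last lra.
  have tsN : 0 < t_ N / s by rewrite divr_gt0 // tN0.
  have := atan_inv tsN; rewrite invf_div => ae.
  have -> : F (t_ N) = s * (pi / 2) - s * atan (s / t_ N) by rewrite /F -ae; ring.
  rewrite lerD2l lerN2 expr2 -mulrA ler_pM2l //.
  by apply: atan_le; rewrite divr_gt0 // tN0.
set S := h * \sum_(j < N) g (t_ j.+1) in up lo *.
have key (q : R) : q != 0 -> s - 2 / q * S = 2 / q * (s * (q / 2) - S).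
  by move=> q0; field.
rewrite key ?gt_eqF //; apply/andP; split.
  by rewrite mulr_ge0 ?divr_ge0 ?(ltW pi0) // subr_ge0 (le_trans up).
rewrite ler_pM2l ?divr_gt0 // -/(t_ N).
by move: lo Fge; lra.
Qed.

(** * Stieltjes-type transform of the limiting law *)

Local Open Scope classical_set_scope.

Lemma is_derive_sqr_sub (R : realType) (c x : R) : is_derive x 1 (fun x : R => x ^+ 2 - c) (2 * x).
Proof.
apply: (is_derive_eq (is_deriveB (is_deriveX 2 (is_derive_id x 1)) (is_derive_cst c x 1))).
by rewrite subr0 /= expr1; exact: mulr1.
Qed.

Lemma is_derive_sub_sqr (R : realType) (c x : R) :
  is_derive x 1 (fun x : R => c - x ^+ 2) (- (2 * x)).
Proof.
apply: (is_derive_eq (is_deriveB (is_derive_cst c x 1) (is_deriveX 2 (is_derive_id x 1)))).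
by rewrite sub0r /= expr1; congr (- _); exact: mulr1.
Qed.

Lemma is_derive_sqrt_prod (R : realType) (a b x : R)
    (P := fun x : R => Num.sqrt ((b - x ^+ 2) * (x ^+ 2 - a))) :
  0 < (b - x ^+ 2) * (x ^+ 2 - a) ->
  is_derive x 1 P (x * (a + b - 2 * x ^+ 2) / P x).
Proof.
move=> h0.
have d1 := is_deriveM (is_derive_sub_sqr b x) (is_derive_sqr_sub a x).
apply: (is_derive_eq (is_derive1_comp (f := Num.sqrt)
  (g := fun x : R => (b - x ^+ 2) * (x ^+ 2 - a)) (is_derive1_sqrt h0) d1)).
rewrite -/(P x); have : P x != 0 by rewrite gt_eqF // sqrtr_gt0.
move: (P x) => q q0; rewrite -![_ *: _]/(_ * _); field => //.
Qed.

Lemma is_derive_atan_frac (R : realType) (a b k x : R)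
    (g := fun x : R => (x ^+ 2 - a) / (b - x ^+ 2)) :
  b - x ^+ 2 != 0 -> 0 < g x ->
  is_derive x 1 (fun x : R => atan (k * Num.sqrt (g x)))
    (k * (x * (b - a) / ((b - x ^+ 2) ^+ 2 * Num.sqrt (g x))) / (1 + k ^+ 2 * g x)).
Proof.
move=> bx g0.
have dV := @is_deriveV _ (fun x : R => b - x ^+ 2) x _ 1 bx (is_derive_sub_sqr b x).
have dg : is_derive x 1 g (2 * x * (b - a) / (b - x ^+ 2) ^+ 2).
  apply: (is_derive_eq (is_deriveM (is_derive_sqr_sub a x) dV)).
  by rewrite -![_ *: _]/(_ * _); field.
have ds := is_deriveZ k (is_derive1_comp (f := Num.sqrt) (is_derive1_sqrt g0) dg).
apply: (is_derive_eq (is_derive1_comp (f := @atan R) (is_derive1_atan _) ds)).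
have s0 : Num.sqrt (g x) != 0 by rewrite gt_eqF // sqrtr_gt0.
have s2 : Num.sqrt (g x) ^+ 2 = g x by rewrite sqr_sqrtr // ltW.
rewrite -![_ *: _]/(_ * _) /=; move: s2; move: (Num.sqrt (g x)) s0 => s s0 <-.
rewrite exprMn.
have k0 : 1 + k ^+ 2 * s ^+ 2 != 0.
  by rewrite gt_eqF // ltr_wpDr // mulr_ge0 ?sqr_ge0.
by field; rewrite exprMn k0 s0.
Qed.

Lemma continuous_sqrt_prod (R : realType) (a b : R) :
  continuous (fun x : R => Num.sqrt ((b - x ^+ 2) * (x ^+ 2 - a))).
Proof.
move=> x; apply: (@continuous_comp _ _ _
  (fun x : R => (b - x ^+ 2) * (x ^+ 2 - a)) Num.sqrt); last exact: sqrt_continuous.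
by apply: cvgM; apply: cvgB; (exact: cvg_cst || exact: exprn_continuous).
Qed.

Lemma continuous_atan_frac (R : realType) (a b k x : R) : b - x ^+ 2 != 0 ->
  {for x, continuous (fun x : R => atan (k * Num.sqrt ((x ^+ 2 - a) / (b - x ^+ 2))))}.
Proof.
move=> bx; apply: (@continuous_comp _ _ _
  (fun x : R => k * Num.sqrt ((x ^+ 2 - a) / (b - x ^+ 2))) (@atan R)); last exact: continuous_atan.
apply: cvgMr.
apply: (@continuous_comp _ _ _
  (fun x : R => (x ^+ 2 - a) / (b - x ^+ 2)) Num.sqrt); last exact: sqrt_continuous.
apply: cvgM; first by apply: cvgB; (exact: cvg_cst || exact: exprn_continuous).
by apply: cvgV => //; apply: cvgB; (exact: cvg_cst || exact: exprn_continuous).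
Qed.

(** At the ends only continuity is asked of [F], as the primitives below contain square roots that
    vanish there. *)
Lemma Rintegral_FTC (R : realType) (f F : R -> R) (u v : R) : u < v ->
  {within `[u, v], continuous f} ->
  (forall x, u <= x <= v -> {for x, continuous F}) ->
  (forall x, u < x < v -> is_derive x 1 F (f x)) ->
  \int[lebesgue_measure]_(x in `[u, v]) f x = F v - F u.
Proof.
move=> uv cf cF dF; rewrite /Rintegral (@continuous_FTC2 _ f F) //.
- split.
  + by move=> x; rewrite in_itv /= => /dF ?; apply: ex_derive.
  + by apply: cvg_at_right_filter; apply: cF; rewrite lexx ltW.
  + by apply: cvg_at_left_filter; apply: cF; rewrite lexx ltW.
- by move=> x; rewrite in_itv /= => /dF ?; rewrite derive1E derive_val.
Qed.

Lemma integrable_segment (R : realType) (f : R -> R) (u v : R) :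
  {within `[u, v], continuous f} ->
  (@lebesgue_measure R).-integrable `[u, v] (EFin \o f).
Proof. by move=> cf; apply: continuous_compact_integrable => //; exact: segment_compact. Qed.

Lemma continuous_mp (R : realType) (a b e : R) : 0 < e ->
  continuous (fun x : R => x * Num.sqrt ((b - x ^+ 2) * (x ^+ 2 - a)) / (x ^+ 2 + e)).
Proof.
move=> e0 x; apply: cvgM.
  by apply: cvgM; [exact: cvg_id | exact: continuous_sqrt_prod].
apply: cvgV; first by rewrite gt_eqF // ltr_wpDl ?sqr_ge0.
by apply: cvgD; (exact: cvg_cst || exact: exprn_continuous).
Qed.

(* [sg] is the sign of [b - x^2]: exchanging [a] and [b] and taking [sg = -1] gives a primitive
   that is regular at the other endpoint. *)
Lemma mp_primitive (R : realType) (a b e sg x : R)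
    (P := fun x : R => Num.sqrt ((b - x ^+ 2) * (x ^+ 2 - a)))
    (s := Num.sqrt ((a + e) * (b + e)))
    (F := fun x : R => 2^-1 * (P x
      + sg * (a + b + 2 * e) * atan (1 * Num.sqrt ((x ^+ 2 - a) / (b - x ^+ 2)))
      - sg * 2 * s * atan (s / (a + e) * Num.sqrt ((x ^+ 2 - a) / (b - x ^+ 2))))) :
  0 < (b - x ^+ 2) * (x ^+ 2 - a) -> 0 < e -> 0 <= a -> 0 <= b ->
  sg ^+ 2 = 1 -> 0 < sg * (b - x ^+ 2) ->
  is_derive x 1 F (x * P x / (x ^+ 2 + e)).
Proof.
move=> h0 e0 a0 b0 sg1 bx0.
have bx : b - x ^+ 2 != 0.
  by apply: contraTneq bx0 => ->; rewrite mulr0 ltxx.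
have g0 : 0 < (x ^+ 2 - a) / (b - x ^+ 2).
  have -> : (x ^+ 2 - a) / (b - x ^+ 2) =
    ((b - x ^+ 2) * (x ^+ 2 - a)) / (b - x ^+ 2) ^+ 2 by field.
  by rewrite divr_gt0 // exprn_even_gt0.
have P0 : P x != 0 by rewrite gt_eqF // sqrtr_gt0.
have Px0 : 0 <= P x by apply: sqrtr_ge0.
have P2 : P x ^+ 2 = (b - x ^+ 2) * (x ^+ 2 - a) by rewrite sqr_sqrtr // ltW.
have gE : Num.sqrt ((x ^+ 2 - a) / (b - x ^+ 2)) = P x / (sg * (b - x ^+ 2)).
  apply/eqP; rewrite -(@eqrXn2 _ 2) ?sqrtr_ge0 ?(divr_ge0 Px0 (ltW bx0)) //.
  rewrite sqr_sqrtr ?(ltW g0) // expr_div_n P2 exprMn sg1 mul1r.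
  by apply/eqP; field.
have s2 : s ^+ 2 = (a + e) * (b + e) by rewrite sqr_sqrtr // mulr_ge0 // addr_ge0 // ltW.
have ae : a + e != 0 by rewrite gt_eqF // ltr_wpDl.
have xe : x ^+ 2 + e != 0 by rewrite gt_eqF // ltr_wpDl ?sqr_ge0.
have sg0 : sg != 0 by apply: contraTneq bx0 => ->; rewrite mul0r ltxx.
have da (k : R) := is_derive_atan_frac k bx g0.
have d1 := is_deriveZ (sg * (a + b + 2 * e)) (da 1).
have d2 := is_deriveZ (sg * 2 * s) (da (s / (a + e))).
have := is_deriveZ 2^-1 (is_deriveB (is_deriveD (is_derive_sqrt_prod h0) d1) d2).
move=> dF; have {}dF : is_derive x 1 F _ := dF.
apply: (is_derive_eq dF); rewrite -![_ *: _]/(_ * _) -/(P x) gE.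
have gg : (x ^+ 2 - a) / (b - x ^+ 2) = P x ^+ 2 / (b - x ^+ 2) ^+ 2.
  by rewrite P2; field.
have ba : b != a.
  apply: contraTneq h0 => ->; rewrite -leNgt -opprB mulNr oppr_le0 -expr2 sqr_ge0 //.
have -> : 1 + 1 ^+ 2 * ((x ^+ 2 - a) / (b - x ^+ 2)) = (b - a) / (b - x ^+ 2) by field.
have -> : 1 + (s / (a + e)) ^+ 2 * ((x ^+ 2 - a) / (b - x ^+ 2)) =
    (b - a) * (x ^+ 2 + e) / ((a + e) * (b - x ^+ 2)).
  by rewrite expr_div_n s2; field; rewrite ae bx.
have ba' : b - a != 0 by rewrite subr_eq0.
clear - sg1 s2 P2 P0 ba' ae xe bx sg0.
move: (P x) P2 P0 => q q2 q0; move: s s2 => {}s s2.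
(* With [sg^2 = 1] and [s^2 = (a + e)(b + e)], the large parenthesis collapses to
   [2 (b - x^2)(x^2 - a)], that is [2 q^2]. *)
transitivity (x * ((a + b - 2 * x ^+ 2) * (x ^+ 2 + e) + sg ^+ 2 * (a + b + 2 * e) * (x ^+ 2 + e)
   - sg ^+ 2 * 2 * s ^+ 2) / (2 * q * (x ^+ 2 + e))).
  by field; rewrite xe q0 ae ba' bx sg0.
rewrite sg1 s2.
transitivity (x * q ^+ 2 / (q * (x ^+ 2 + e))); last by field; rewrite xe q0.
by rewrite q2; field; rewrite xe q0.
Qed.

Lemma mp_integral (R : realType) (a b e : R) : 0 <= a -> a < b -> 0 < e ->
  \int[lebesgue_measure]_(x in `[Num.sqrt a, Num.sqrt b])
     (x * Num.sqrt ((b - x ^+ 2) * (x ^+ 2 - a)) / (x ^+ 2 + e))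
  = pi / 2 * ((a + b) / 2 + e - Num.sqrt ((a + e) * (b + e))).
Proof.
move=> a0 ab e0; have b0 : 0 < b by apply: le_lt_trans ab.
set s := Num.sqrt ((a + e) * (b + e)).
pose f (x : R) := x * Num.sqrt ((b - x ^+ 2) * (x ^+ 2 - a)) / (x ^+ 2 + e).
have cf : continuous f by apply: continuous_mp.
(* At this cut both square-root arguments equal 1. The arctangents become [pi / 4] and those of
   [s / (a + e)] and [s / (b + e)], which are reciprocal and so add up to [pi / 2]. *)
pose m := Num.sqrt ((a + b) / 2).
have m2 : m ^+ 2 = (a + b) / 2 by rewrite sqr_sqrtr //; lra.
have am : Num.sqrt a < m by rewrite ltr_sqrt; lra.
have mb : m < Num.sqrt b by rewrite ltr_sqrt //; lra.
have sa : Num.sqrt a ^+ 2 = a by rewrite sqr_sqrtr.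
have sb : Num.sqrt b ^+ 2 = b by rewrite sqr_sqrtr // ltW.
have a0' : 0 <= Num.sqrt a by apply: sqrtr_ge0.
pose P (x : R) := Num.sqrt ((b - x ^+ 2) * (x ^+ 2 - a)).
pose FL (x : R) := 2^-1 * (P x
      + 1 * (a + b + 2 * e) * atan (1 * Num.sqrt ((x ^+ 2 - a) / (b - x ^+ 2)))
      - 1 * 2 * s * atan (s / (a + e) * Num.sqrt ((x ^+ 2 - a) / (b - x ^+ 2)))).
pose FR (x : R) := 2^-1 * (P x
      + (-1) * (a + b + 2 * e) * atan (1 * Num.sqrt ((x ^+ 2 - b) / (a - x ^+ 2)))
      - (-1) * 2 * s * atan (s / (b + e) * Num.sqrt ((x ^+ 2 - b) / (a - x ^+ 2)))).
have sqr_lt (u v : R) : 0 <= u -> u < v -> u ^+ 2 < v ^+ 2.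
  by move=> u0 uv; rewrite ltrXn2r ?nnegrE // (le_trans u0) // ltW.
have uL : Num.sqrt ((m ^+ 2 - a) / (b - m ^+ 2)) = 1.
  have -> : m ^+ 2 - a = b - m ^+ 2 by lra.
  by rewrite divff ?sqrtr1 // gt_eqF //; lra.
have uR : Num.sqrt ((m ^+ 2 - b) / (a - m ^+ 2)) = 1.
  have -> : m ^+ 2 - b = a - m ^+ 2 by lra.
  by rewrite divff ?sqrtr1 // lt_eqF //; lra.
have left : \int[lebesgue_measure]_(x in `[Num.sqrt a, m]) f x = FL m - FL (Num.sqrt a).
  apply: Rintegral_FTC => //.
  - by apply: continuous_subspaceT.
  - move=> x /andP[ax xm].
    have bx : b - x ^+ 2 != 0.
      have : x ^+ 2 <= m ^+ 2 by rewrite lerXn2r ?nnegrE ?sqrtr_ge0 // (le_trans a0').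
      by rewrite m2 => ?; rewrite gt_eqF //; lra.
    apply: cvgMr; apply: cvgB; first apply: cvgD; first exact: continuous_sqrt_prod.
      by apply: cvgMr; exact: continuous_atan_frac.
    by apply: cvgMr; exact: continuous_atan_frac.
  - move=> x /andP[ax xm].
    have h1 := sqr_lt _ _ a0' ax; have := sqr_lt _ _ (le_trans a0' (ltW ax)) xm.
    rewrite m2 sa in h1 * => h2.
    apply: mp_primitive => //; rewrite ?expr1n ?mul1r ?(ltW b0) ?mulr_gt0 //; lra.
have right : \int[lebesgue_measure]_(x in `[m, Num.sqrt b]) f x = FR (Num.sqrt b) - FR m.
  apply: Rintegral_FTC => //.
  - by apply: continuous_subspaceT.
  - move=> x /andP[mx xb].
    have ax : a - x ^+ 2 != 0.
      have : m ^+ 2 <= x ^+ 2 by rewrite lerXn2r ?nnegrE ?sqrtr_ge0 // (le_trans _ mx) ?sqrtr_ge0.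
      by rewrite m2 => ?; rewrite lt_eqF //; lra.
    apply: cvgMr; apply: cvgB; first apply: cvgD; first exact: continuous_sqrt_prod.
      by apply: cvgMr; exact: continuous_atan_frac.
    by apply: cvgMr; exact: continuous_atan_frac.
  - move=> x /andP[mx xb].
    have m0 : 0 <= m by apply: sqrtr_ge0.
    have h1 := sqr_lt _ _ m0 mx; have := sqr_lt _ _ (le_trans m0 (ltW mx)) xb.
    rewrite m2 sb in h1 * => h2.
    have PE y : P y = Num.sqrt ((a - y ^+ 2) * (y ^+ 2 - b)) by rewrite /P; congr Num.sqrt; ring.
    have sE : s = Num.sqrt ((b + e) * (a + e)) by rewrite /s mulrC.
    rewrite /f -/(P x) PE.
    have -> : FR = (fun x : R => 2^-1 * (Num.sqrt ((a - x ^+ 2) * (x ^+ 2 - b))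
      + -1 * (b + a + 2 * e) * atan (1 * Num.sqrt ((x ^+ 2 - b) / (a - x ^+ 2)))
      - -1 * 2 * Num.sqrt ((b + e) * (a + e))
        * atan (Num.sqrt ((b + e) * (a + e)) / (b + e) * Num.sqrt ((x ^+ 2 - b) / (a - x ^+ 2))))).
      by apply/funext => y; rewrite /FR PE -sE [b + a]addrC.
    apply: mp_primitive => //; rewrite ?sqrrN ?expr1n ?(ltW b0) //.
      by rewrite -mulrNN mulr_gt0 //; lra.
    lra.
(* each primitive is singular at one of the two endpoints, hence the cut at [m] *)
have split_int : \int[lebesgue_measure]_(x in `[Num.sqrt a, Num.sqrt b]) f x =
    \int[lebesgue_measure]_(x in `[Num.sqrt a, m]) f x
    + \int[lebesgue_measure]_(x in `[m, Num.sqrt b]) f x.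
  rewrite -[X in _ + X]Rintegral_itv_obnd_cbnd; last first.
    apply: integrableS (integrable_segment (continuous_subspaceT cf)) => //.
    by apply: subset_itvr; rewrite bnd_simp.
  rewrite -(@Rintegral_itvB _ f (BLeft (Num.sqrt a)) (BRight (Num.sqrt b)) m).
  - by rewrite addrC subrK.
  - by apply: integrable_segment; apply: continuous_subspaceT.
  - by rewrite bnd_simp ltW.
  - by rewrite bnd_simp ltW.
rewrite -/(f) split_int left right.
have FLa : FL (Num.sqrt a) = 0.
  by rewrite /FL /P sa subrr mulr0 mul0r sqrtr0 !mulr0 atan0 !mulr0 addr0 subr0 mulr0.
have FRb : FR (Num.sqrt b) = 0.
  by rewrite /FR /P sb subrr mul0r !mul0r sqrtr0 !mulr0 atan0 !mulr0 addr0 subr0 mulr0.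
have s0 : 0 < s by rewrite sqrtr_gt0 mulr_gt0 ?ltr_wpDl // ltW.
have kappa : s / (b + e) = (s / (a + e))^-1.
  have s2 : s * s = (a + e) * (b + e).
    by rewrite -expr2 sqr_sqrtr // mulr_ge0 // addr_ge0 // ltW.
  have be0 : b + e != 0 by rewrite gt_eqF // ltr_wpDl // ltW.
  by rewrite invf_div; apply/eqP; rewrite eqr_div ?s2 // gt_eqF.
have := atan_inv (divr_gt0 s0 (ltr_wpDl a0 e0)).
rewrite FLa FRb /FL /FR uL uR kappa !mulr1 atan1.
set A := atan _; set B := atan _ => AB.
have -> : pi / 2 * ((a + b) / 2 + e - s) = (pi / 4 + pi / 4) / 2 * (a + b + 2 * e) - (pi / 2) * s.
  by move: (pi : R) => q; field.
by rewrite -AB; move: (pi : R) => q; field.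
Qed.

(** The root [T] of [fixpoint_solution] divided by [s2]: dividing the limiting equation by [l1] and
    putting [T = s2 * tau] gives [T / (1 + T) + e * T = y]. *)
Definition limit_ptrace (R : rcfType) (l1 s2 y t : R) : R :=
  let e := t ^+ 2 / (l1 * s2) in
  (y - 1 - e + Num.sqrt ((1 + y + e) ^+ 2 - 4 * y)) / (2 * e) / s2.

Lemma limit_ptraceP (R : rcfType) (l1 s2 y t : R) (tau := limit_ptrace l1 s2 y t) :
  0 < l1 -> 0 < s2 -> 0 < y -> 0 < t ->
  0 <= tau /\ l1 * (s2 * tau / (1 + s2 * tau)) + t ^+ 2 * tau = l1 * y.
Proof.
move=> l0 s0 y0 t0; have e0 : 0 < t ^+ 2 / (l1 * s2) by rewrite divr_gt0 ?mulr_gt0 ?exprn_gt0.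
have [] := fixpoint_solution y0 e0; rewrite /tau /limit_ptrace.
set T := _ / (2 * _) => T0 TE; rewrite divr_ge0 ?(ltW s0) //; split => //.
have -> : s2 * (T / s2) = T by field; rewrite gt_eqF.
by rewrite -[in RHS]TE; move: T0 {TE} => T0; field; rewrite !gt_eqF // ltr_pwDl.
Qed.

(** Continuity is carried through the induction because additivity of the integral needs the partial
    sum to be integrable. *)
Lemma Rintegral_sum_continuous (R : realType) N (f : 'I_N -> R -> R) (u v : R) :
  (forall j, continuous (f j)) ->
  continuous (fun x => \sum_(j < N) f j x) /\
  \int[lebesgue_measure]_(x in `[u, v]) (\sum_(j < N) f j x)
  = \sum_(j < N) \int[lebesgue_measure]_(x in `[u, v]) f j x.
Proof.
elim: N f => [|N IH] f cf.
  split.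
    move=> x; rewrite (_ : (fun _ => _) = cst 0) ?big_ord0; first exact: cvg_cst.
    by apply/funext => z; rewrite big_ord0.
  rewrite big_ord0 (_ : (fun _ => _) = cst 0); last by apply/funext => z; rewrite big_ord0.
  by rewrite Rintegral_cst // mul0r.
have [c1 i1] := IH (fun j => f (widen_ord (leqnSn N) j)) (fun j => cf _).
have FE : (fun x => \sum_(j < N.+1) f j x) =
    (fun x => \sum_(j < N) f (widen_ord (leqnSn N) j) x + f ord_max x).
  by apply/funext => x; rewrite big_ord_recr.
rewrite FE; split.
  by move=> x; apply: cvgD; [exact: c1 | exact: cf].
rewrite RintegralD //; last 2 first.
- by apply: integrable_segment; apply: continuous_subspaceT.
- by apply: integrable_segment; apply: continuous_subspaceT.
by rewrite i1 big_ord_recr.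
Qed.

(** Both sides equal [l1 (1 + y + e - S) / 2]: up to the factor [s2], the square root in
    [mp_integral] is that of the discriminant of the quadratic equation. *)
Lemma mp_transform (R : realType) (p y l1 t : R) (s2 := p * (1 - p))
    (a := s2 * (1 - Num.sqrt y) ^+ 2) (b := s2 * (1 + Num.sqrt y) ^+ 2) :
  0 < s2 -> 0 < y -> 0 < l1 -> 0 < t ->
  l1 * y * ((pi * p * (1 - p) * y)^-1 * \int[lebesgue_measure]_(x in `[Num.sqrt a, Num.sqrt b])
     (x * Num.sqrt ((b - x ^+ 2) * (x ^+ 2 - a)) / (x ^+ 2 + t ^+ 2 / l1)))
  = l1 * y - t ^+ 2 * limit_ptrace l1 s2 y t.
Proof.
move=> s0 y0 l0 t0.
have ry0 : 0 < Num.sqrt y by rewrite sqrtr_gt0.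
have ry2 : Num.sqrt y ^+ 2 = y by rewrite sqr_sqrtr // ltW.
have e0 : 0 < t ^+ 2 / l1 by rewrite divr_gt0 ?exprn_gt0.
rewrite mp_integral //; last 2 first.
- by rewrite mulr_ge0 ?sqr_ge0 // ltW.
- by rewrite ltr_pM2l //; nra.
rewrite /limit_ptrace; set e := t ^+ 2 / (l1 * s2); set S := Num.sqrt ((1 + y + e) ^+ 2 - _).
have eE : t ^+ 2 / l1 = s2 * e by rewrite /e; field; rewrite !gt_eqF.
have tE : t ^+ 2 = l1 * s2 * e by rewrite /e; field; rewrite !gt_eqF.
have en0 : 0 < e by apply: divr_gt0; [exact: exprn_gt0 | exact: mulr_gt0].
have -> : Num.sqrt ((a + t ^+ 2 / l1) * (b + t ^+ 2 / l1)) = s2 * S.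
  have -> : (a + t ^+ 2 / l1) * (b + t ^+ 2 / l1) = s2 ^+ 2 * ((1 + y + e) ^+ 2 - 4 * y).
    by rewrite eE /a /b; move: ry2; move: (Num.sqrt y) => r <-; ring.
  by rewrite sqrtrM ?sqr_ge0 // sqrtr_sqr ger0_norm // ltW.
have -> : (a + b) / 2 = s2 * (1 + y) by rewrite /a /b; move: ry2; move: (Num.sqrt y) => r <-; field.
rewrite eE tE; have -> : pi * p * (1 - p) * y = pi * s2 * y by rewrite /s2 !mulrA.
have := pi_gt0 R; move: (pi : R) => q q0.
clearbody s2 S e; field.
by rewrite !gt_eqF.
Qed.

(** Apply [coulson_sum] under the integral at [s = Num.sqrt l1 * x], with weight [K * P x / x], and
    integrate the pointwise error over an interval of length at most [Num.sqrt b]. *)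
Lemma Lambda_coulson (R : realType) (p y l1 h : R) N (s2 := p * (1 - p)) :
  0 < p < 1 -> 0 < y -> 0 < l1 -> 0 < h -> (0 < N)%N ->
  `|l1 * y * Num.sqrt l1 * Lambda p y
    - 2 / pi * (h * \sum_(j < N) (l1 * y - (j.+1%:R * h) ^+ 2
        * limit_ptrace l1 s2 y (j.+1%:R * h)))|
  <= l1 * (1 + Num.sqrt y) ^+ 2 * (h + l1 * (1 + Num.sqrt y) ^+ 2 / (N%:R * h)).
Proof.
move=> p01 y0 l0 h0 N0.
have s0 : 0 < s2 by rewrite /s2; case/andP: p01 => ? ?; rewrite mulr_gt0 ?subr_gt0.
have pi0 := pi_gt0 R.
pose a := s2 * (1 - Num.sqrt y) ^+ 2; pose b := s2 * (1 + Num.sqrt y) ^+ 2.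
pose K : R := (pi * p * (1 - p) * y)^-1.
have KE : K = (pi * s2 * y)^-1 by rewrite /K /s2 !mulrA.
have K0 : 0 < K by rewrite KE invr_gt0; apply: mulr_gt0 => //; apply: mulr_gt0.
pose P (x : R) := Num.sqrt ((b - x ^+ 2) * (x ^+ 2 - a)).
have ry0 : 0 < Num.sqrt y by rewrite sqrtr_gt0.
have a0 : 0 <= a by rewrite mulr_ge0 ?sqr_ge0 // ltW.
have ab : a < b by rewrite ltr_pM2l //; nra.
have b0 : 0 < b by apply: le_lt_trans ab.
have Nh0 : 0 < N%:R * h by rewrite mulr_gt0 // ltr0n.
have lb0 : 0 <= l1 * b by apply: mulr_ge0; apply: ltW.
have hB0 : 0 <= h + l1 * b / (N%:R * h).
  by apply: addr_ge0; [exact: ltW | apply: divr_ge0 => //; exact: ltW].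
have Kb0 : 0 <= K * Num.sqrt b by apply: mulr_ge0; [exact: ltW | exact: sqrtr_ge0].
pose tt (j : 'I_N) : R := j.+1%:R * h.
have t0 j : 0 < tt j by rewrite mulr_gt0 // ltr0n.
pose f (j : 'I_N) (x : R) := K * (x * P x / (x ^+ 2 + tt j ^+ 2 / l1)).
have e0 j : 0 < tt j ^+ 2 / l1 by rewrite divr_gt0 ?exprn_gt0.
have cmp j := @continuous_mp R a b (tt j ^+ 2 / l1) (e0 j).
have cf j : continuous (f j) by move=> x; apply: cvgMr; exact: cmp.
have cP : continuous (fun x : R => K * P x).
  by move=> x; apply: cvgMr; exact: continuous_sqrt_prod.
pose I (g : R -> R) := \int[lebesgue_measure]_(x in `[Num.sqrt a, Num.sqrt b]) g x.
have iC (g : R -> R) : continuous g ->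
    lebesgue_measure.-integrable `[Num.sqrt a, Num.sqrt b] (EFin \o g).
  by move=> cg; apply: integrable_segment; apply: continuous_subspaceT.
have IZ (c : R) (g : R -> R) : continuous g -> I (fun x => c * g x) = c * I g.
  by move=> cg; rewrite /I RintegralZl //; exact: iC.
have [cS iS] := Rintegral_sum_continuous (Num.sqrt a) (Num.sqrt b) cf.
have If j : l1 * y * I (f j) = l1 * y - tt j ^+ 2 * limit_ptrace l1 s2 y (tt j).
  by rewrite -mp_transform // /f IZ //; exact: cmp.
pose G (x : R) := Num.sqrt l1 * (K * P x) - (2 / pi * h) * \sum_(j < N) f j x.
have cG : continuous G.
  by move=> x; apply: cvgB; apply: cvgMr; [exact: cP | exact: cS].
have IG : I G = Num.sqrt l1 * Lambda p y - 2 / pi * h * \sum_(j < N) I (f j).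
  rewrite -(IZ _ (fun x => K * P x)) // -iS -(IZ _ (fun x => \sum_(j < N) f j x)) //.
  rewrite /I -RintegralB //; apply: iC => x; apply: cvgMr; [exact: cP | exact: cS].
have s21 : s2 <= 1 by rewrite /s2; case/andP: p01; nra.
have bE : b = s2 * (1 + Num.sqrt y) ^+ 2 by [].
clearbody a b s2.
pose B := K * Num.sqrt b * (h + l1 * b / (N%:R * h)).
have Gb x : Num.sqrt a <= x <= Num.sqrt b -> 0 <= G x <= B.
  move=> /andP[ax xb].
  have x0 : 0 <= x by apply: le_trans ax; apply: sqrtr_ge0.
  have b2 : x ^+ 2 <= b by rewrite -[b]sqr_sqrtr ?lerXn2r ?nnegrE ?sqrtr_ge0 // ltW.
  (* The point [x = 0] lies in the interval only if [a = 0]; it is treated apart because the weight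
     divides by [x]. *)
  move: x0; rewrite le_eqVlt => /predU1P[x0|x0].
    have a00 : a = 0.
      apply/eqP; rewrite eq_le a0 andbT -sqrtr_eq0 eq_le sqrtr_ge0 andbT.
      by rewrite x0.
    have G0 : G x = 0.
      rewrite /G /f big1 => [|j _].
        by rewrite /P a00 -x0 expr0n /= subrr mulr0 sqrtr0 !mulr0 subr0.
      by rewrite -x0 !mul0r mulr0.
    by rewrite G0 lexx; apply: mulr_ge0.
  pose s := Num.sqrt l1 * x.
  have s_gt0 : 0 < s by rewrite mulr_gt0 // sqrtr_gt0.
  have s_2 : s ^+ 2 = l1 * x ^+ 2 by rewrite exprMn sqr_sqrtr // ltW.
  have := coulson_sum (ltW s_gt0) h0 N0.
  set X := s - _ => /andP[X0 X1].
  have GE : G x = K * P x / x * X.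
    rewrite /G /X (_ : \sum_(j < N) f j x =
       K * P x / x * \sum_(j < N) s ^+ 2 / (s ^+ 2 + (j.+1%:R * h) ^+ 2)).
      by rewrite /s; move: (2 / pi : R) => c; field; rewrite gt_eqF.
    rewrite mulr_sumr; apply: eq_bigr => j _; rewrite /f s_2 -/(tt j).
    by field; rewrite !gt_eqF // ltr_wpDl ?exprn_gt0 // mulr_ge0 ?sqr_ge0 // ltW.
  have Px : P x / x <= Num.sqrt b.
    rewrite ler_pdivrMr //.
    have -> : Num.sqrt b * x = Num.sqrt (b * x ^+ 2).
      by rewrite sqrtrM ?(ltW b0) // sqrtr_sqr ger0_norm // ltW.
    rewrite ler_sqrt ?(mulr_ge0 (ltW b0) (sqr_ge0 x)) //.
    apply: ler_pM; rewrite ?subr_ge0 ?lerBlDr ?lerDl ?sqr_ge0 //.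
    by rewrite -[a]sqr_sqrtr ?lerXn2r ?nnegrE ?sqrtr_ge0 ?(ltW x0).
  have Px0 : 0 <= P x / x by rewrite divr_ge0 ?sqrtr_ge0 // ltW.
  have KP0 : 0 <= K * P x / x by rewrite -mulrA mulr_ge0 // ltW.
    rewrite GE mulr_ge0 //=; apply: ler_pM => //.
    by rewrite -mulrA ler_pM2l.
  apply: le_trans X1 _.
  have X2 : h + s ^+ 2 / (N%:R * h) <= h + l1 * b / (N%:R * h).
    by rewrite lerD2l ler_pM2r ?invr_gt0 ?mulr_gt0 ?ltr0n // s_2 ler_pM2l.
  apply: le_trans X2; rewrite ler_piMl //.
    by rewrite addr_ge0 ?(ltW h0) // divr_ge0 ?sqr_ge0 // mulr_ge0 // ltW.
  by rewrite ler_pdivrMr // mul1r; have := pi_ge2 R.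
have IGb : 0 <= I G <= B * Num.sqrt b.
  apply/andP; split; first by apply: Rintegral_ge0 => x; rewrite /= in_itv /= => /Gb /andP[].
  apply: (@le_trans _ _ (I (cst B))).
    apply: le_Rintegral => //; [exact: iC | apply: iC => x; exact: cvg_cst|].
    by move=> x; rewrite /= in_itv /= => /Gb /andP[].
  rewrite /I Rintegral_cst //.
  have mE := @lebesgue_measure_itv R `[Num.sqrt a, Num.sqrt b]%R.
  rewrite /= lte_fin ltr_sqrt // ab in mE.
  rewrite [fine _](_ : _ = Num.sqrt b - Num.sqrt a); last exact: (congr1 fine mE).
  have B0 : 0 <= B by apply: mulr_ge0.
  by rewrite ler_wpM2l // gerBl sqrtr_ge0.
have -> : l1 * y * Num.sqrt l1 * Lambda p y
    - 2 / pi * (h * \sum_(j < N) (l1 * y - (j.+1%:R * h) ^+ 2 * limit_ptrace l1 s2 y (j.+1%:R * h)))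
    = l1 * y * I G.
  rewrite IG (eq_bigr (fun j => l1 * y * I (f j))); last by move=> j _; rewrite If.
  by rewrite -mulr_sumr; move: (pi : R) => q; ring.
move: IGb => /andP[IG0 IG1].
rewrite ger0_norm ?mulr_ge0 ?(ltW y0) ?(ltW l0) //.
apply: le_trans (ler_wpM2l _ IG1) _; first by rewrite mulr_ge0 // ltW.
have -> : l1 * y * (B * Num.sqrt b) =
    l1 * (1 + Num.sqrt y) ^+ 2 * (pi^-1 * (h + l1 * b / (N%:R * h))).
  rewrite /B KE.
  have -> : l1 * y * ((pi * s2 * y)^-1 * Num.sqrt b * (h + l1 * b / (N%:R * h))
        * Num.sqrt b) =
     l1 * y * ((pi * s2 * y)^-1 * (Num.sqrt b ^+ 2) * (h + l1 * b / (N%:R * h))) by ring.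
  rewrite sqr_sqrtr ?(ltW b0) // [X in _ * (_ * X * _)]bE.
  by move: pi0 (h + _); move: (pi : R) => q q0 Z; field; rewrite !gt_eqF.
rewrite ler_pM2l ?mulr_gt0 ?exprn_gt0 ?addr_gt0 //.
have bb : b <= (1 + Num.sqrt y) ^+ 2.
  by rewrite bE ler_piMl ?sqr_ge0.
apply: (@le_trans _ _ (h + l1 * b / (N%:R * h))).
  by rewrite ler_piMl //; rewrite invf_le1 //; have := pi_ge2 R; lra.
by rewrite lerD2l ler_pM2r ?invr_gt0 ?mulr_gt0 ?ltr0n // ler_pM2l.
Qed.

Local Close Scope classical_set_scope.

(** * Convergence of the energy *)

Definition self_consistent_defect (R : realFieldType) (p : R) n (V1 V2 : {set 'I_n}) (eta : R)
    (w : {ffun {set 'I_n} -> bool}) : R :=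
  let tau := ptrace V2 (resolvent (gram V1 (centred_row p V2 w)) eta) in
  `|#|V1|%:R * (p * (1 - p) * tau / (1 + p * (1 - p) * tau)) + eta * tau - #|V2|%:R|.

Lemma powR_3half (R : realType) (n : nat) : n%:R `^ (3%:R / 2%:R) = n%:R * Num.sqrt n%:R :> R.
Proof.
have [->|n0] := posnP n; first by rewrite mul0r powR0 // mulf_neq0 ?invr_eq0 ?pnatr_eq0.
have -> : 3%:R / 2%:R = 1 + 2^-1 :> R by field.
by rewrite powRD ?pnatr_eq0 ?gtn_eqF ?implybT // powRr1 ?ler0n // powR12_sqrt ?ler0n.
Qed.

(** A bound valid for every sample [w]; randomness enters only through the defects. Coulson sums are
    taken at [|r i| / Num.sqrt n%:R], whose squares sum to at most [n], and each node is then
    compared with the limiting solution. *)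
Lemma energy_approx (R : realType) (p l1 y h nu1 nu2 : R) n (V1 V2 : {set 'I_n}) N w :
  0 < p < 1 -> 0 < l1 -> 0 < y -> 0 < h -> (0 < N)%N ->
  [disjoint V1 & V2] -> (0 < #|V1|)%N ->
  #|V1|%:R = n%:R * nu1 -> #|V2|%:R = n%:R * nu2 ->
  `|energy R (sampled_graph V1 V2 w) / n%:R `^ (3%:R / 2%:R)
    - 2 * (2 / pi * (h * \sum_(j < N) (l1 * y - (j.+1%:R * h) ^+ 2
         * limit_ptrace l1 (p * (1 - p)) y (j.+1%:R * h))))|
  <= h + (N%:R * h)^-1 + h * \sum_(j < N) (2 / n%:R + 2 * `|nu1 - l1| + 4 * `|nu2 - l1 * y|
       + 2 * (self_consistent_defect p V1 V2 (n%:R * (j.+1%:R * h) ^+ 2) w / n%:R)).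
Proof.
move=> p01 l0 y0 h0 N0 dV V10 n1 n2.
have n0 : (0 < n)%N by rewrite -[n]card_ord; apply: leq_trans V10 (max_card _).
have nR0 : 0 < n%:R :> R by rewrite ltr0n.
have sn0 : 0 < Num.sqrt n%:R :> R by rewrite sqrtr_gt0.
have sn2 : Num.sqrt n%:R ^+ 2 = n%:R :> R by rewrite sqr_sqrtr // ltW.
have s20 : 0 < p * (1 - p) by case/andP: p01 => ? ?; rewrite mulr_gt0 ?subr_gt0.
have [r [rE r2 rR]] := sampled_graph_spectrum p w dV V10.
have Nh0 : 0 < N%:R * h by rewrite mulr_gt0 // ltr0n.
have pi2 := pi_ge2 R; have pi0 := pi_gt0 R.
have q0 : 0 <= 2 / pi :> R by rewrite divr_ge0 // ltW.
have q1 : 2 / pi <= 1 :> R by rewrite ler_pdivrMr // mul1r.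
pose t (j : 'I_N) : R := j.+1%:R * h.
have t0 j : 0 < t j by rewrite mulr_gt0 // ltr0n.
pose Z (j : 'I_N) := n%:R^-1 * \sum_i r i ^+ 2 / (r i ^+ 2 + n%:R * t j ^+ 2).
have step1 : `|energy R (sampled_graph V1 V2 w) / n%:R `^ (3%:R / 2%:R)
    - 2 / pi * (h * \sum_j Z j)| <= h + (N%:R * h)^-1.
  rewrite powR_3half rE.
  pose s i := `|r i| / Num.sqrt n%:R.
  have s0 i : 0 <= s i by rewrite divr_ge0.
  have s2 i : s i ^+ 2 = r i ^+ 2 / n%:R by rewrite expr_div_n sn2 real_normK ?num_real.
  have -> : (\sum_i `|r i|) / (n%:R * Num.sqrt n%:R) = n%:R^-1 * \sum_i s i.
    by rewrite -mulr_suml invfM mulrCA.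
  have -> : \sum_j Z j = n%:R^-1 * \sum_i \sum_(j < N) s i ^+ 2 / (s i ^+ 2 + t j ^+ 2).
    rewrite -mulr_sumr exchange_big /=; congr (_ * _); apply: eq_bigr => i _.
    apply: eq_bigr => j _; rewrite s2; have tj := t0 j.
    have d0 : r i ^+ 2 + n%:R * t j ^+ 2 != 0.
      by rewrite gt_eqF // ltr_wpDl ?sqr_ge0 // mulr_gt0 ?exprn_gt0.
    by field; rewrite gt_eqF //= [t j ^+ 2 * _]mulrC.
  have -> : n%:R^-1 * \sum_i s i - 2 / pi * (h * (n%:R^-1 *
      \sum_i \sum_(j < N) s i ^+ 2 / (s i ^+ 2 + t j ^+ 2))) =
    n%:R^-1 * \sum_i (s i - 2 / pi * (h * \sum_(j < N) s i ^+ 2 / (s i ^+ 2 + t j ^+ 2))).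
    by rewrite sumrB -!mulr_sumr; move: (pi : R) => q; ring.
  rewrite ger0_norm; last first.
    rewrite mulr_ge0 ?invr_ge0 ?(ltW nR0) // sumr_ge0 // => i _.
    by case/andP: (coulson_sum (s0 i) h0 N0).
  rewrite ler_pdivrMl //.
  apply: (@le_trans _ _ (\sum_(i < n) (h + s i ^+ 2 / (N%:R * h)))).
    apply: ler_sum => i _; case/andP: (coulson_sum (s0 i) h0 N0) => _ /le_trans; apply.
    by rewrite ler_piMl // addr_ge0 ?(ltW h0) // divr_ge0 ?sqr_ge0 // ltW.
  rewrite big_split /= sumr_const card_ord -mulr_suml -[h *+ n]mulr_natl.
  rewrite [leRHS]mulrDr lerD2l.
  rewrite ler_pM2r ?invr_gt0 //.
  under eq_bigr => i _ do rewrite s2.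
  by rewrite -mulr_suml ler_pdivrMr // -expr2.
(* The term [2 / n] comes from centring. The coefficient 4 is 2 from the explicit [nu2] and 2 from
   stability of the equation. *)
have step2 j : `|Z j - 2 * (l1 * y - t j ^+ 2 * limit_ptrace l1 (p * (1 - p)) y (t j))| <=
    2 / n%:R + 2 * `|nu1 - l1| + 4 * `|nu2 - l1 * y|
       + 2 * (self_consistent_defect p V1 V2 (n%:R * t j ^+ 2) w / n%:R).
  have tj2 : 0 < t j ^+ 2 by rewrite exprn_gt0.
  have eta0 : 0 < n%:R * t j ^+ 2 by rewrite mulr_gt0.
  have := rR _ eta0; rewrite /self_consistent_defect.
  have := ptrace_resolvent_ge0 V2 (psdmx_gram V1 (centred_row p V2 w)) eta0.
  set tau := ptrace _ _ => tau0; set Y := \sum_i _ => YE.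
  have [u0 uE] := limit_ptraceP l0 s20 y0 (t0 j).
  have := fixpoint_stable nu1 nu2 (ltW s20) tj2 (ltW l0) tau0 u0 uE.
  set u := limit_ptrace _ _ _ _ in u0 uE *.
  set s := p * (1 - p) in s20 uE *.
  have -> : #|V1|%:R * (s * tau / (1 + s * tau)) + n%:R * t j ^+ 2 * tau - #|V2|%:R =
     n%:R * (nu1 * (s * tau / (1 + s * tau)) + t j ^+ 2 * tau - nu2).
    by rewrite n1 n2; ring.
  rewrite [`|n%:R * _|]normrM (gtr0_norm nR0) [n%:R * `|_|]mulrC mulfK ?gt_eqF //.
  set d := `|_ - nu2| => h1.
  have h2 : `|n%:R^-1 * Y - 2 * (nu2 - t j ^+ 2 * tau)| <= 2 / n%:R.
    have -> : n%:R^-1 * Y - 2 * (nu2 - t j ^+ 2 * tau) =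
        (Y - 2 * (#|V2|%:R - n%:R * t j ^+ 2 * tau)) / n%:R.
      by rewrite n2; field; rewrite gt_eqF.
    by rewrite normrM [`|n%:R^-1|]gtr0_norm ?invr_gt0 // ler_pM2r ?invr_gt0.
  rewrite -/Y in h2 *.
  have -> : Z j - 2 * (l1 * y - t j ^+ 2 * u) =
    (n%:R^-1 * Y - 2 * (nu2 - t j ^+ 2 * tau)) + 2 * (nu2 - l1 * y)
    - 2 * (t j ^+ 2 * tau - t j ^+ 2 * u) by rewrite /Z -/Y; ring.
  apply: le_trans (ler_normB _ _) _; rewrite [`|2 * (t j ^+ 2 * _ - _)|]normrM.
  have := ler_normD (n%:R^-1 * Y - 2 * (nu2 - t j ^+ 2 * tau)) (2 * (nu2 - l1 * y)).
  rewrite [`|2 * (nu2 - _)|]normrM !(@ger0_norm _ 2) //.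
  move: h1 h2; lra.
set S := \sum_(j < N) (_ - _).
have -> : 2 * (2 / pi * (h * S)) = 2 / pi * (h * \sum_(j < N)
    2 * (l1 * y - t j ^+ 2 * limit_ptrace l1 (p * (1 - p)) y (t j))).
  by rewrite -mulr_sumr -/S; move: (pi : R) => q; ring.
set E := energy R _ / _ in step1 *; set W := \sum_(j < N) 2 * _.
have -> : E - 2 / pi * (h * W) = (E - 2 / pi * (h * \sum_j Z j)) + 2 / pi * (h * (\sum_j Z j - W)).
  by move: (pi : R) => q; ring.
apply: le_trans (ler_normD _ _) _; apply: lerD => //.
rewrite normrM (ger0_norm q0) normrM (gtr0_norm h0).
apply: (@le_trans _ _ (h * `|\sum_j Z j - W|)).
  by rewrite ler_piMl // mulr_ge0 // ltW.
rewrite ler_pM2l // /W -sumrB; apply: le_trans (ler_norm_sum _ _ _) _.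
by apply: ler_sum => j _; apply: step2.
Qed.

Lemma expect_defect_le (R : realType) (p eta d : R) n (V1 V2 : {set 'I_n}) :
  0 <= p <= 1 -> [disjoint V1 & V2] -> 0 < eta -> 0 < d ->
  expect p (fun w => self_consistent_defect p V1 V2 eta w / n%:R)
  <= d + 2 * n%:R / eta ^+ 2 / d + eta^-1.
Proof.
move=> p01 dV eta0 d0; set B := d + _ + _.
have B0 : 0 <= B.
  rewrite !addr_ge0 ?(ltW d0) ?invr_ge0 ?(ltW eta0) // divr_ge0 ?(ltW d0) //.
  by rewrite divr_ge0 ?sqr_ge0 ?mulr_ge0.
(* For [n = 0] the quotient by [n%:R] is 0 by convention. *)
have [n0|n0] := posnP n.
  have nR0 : n%:R = 0 :> R by rewrite n0.
  rewrite (eq_expect _ (g := fun=> 0)) ?expect_cst // => w.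
  by rewrite nR0 invr0 mulr0.
have nR0 : 0 < n%:R :> R by rewrite ltr0n.
rewrite (eq_expect _ (g := fun w => n%:R^-1 * self_consistent_defect p V1 V2 eta w)); last first.
  by move=> w; rewrite mulrC.
rewrite expectZ ler_pdivrMl //.
apply: le_trans (expect_self_consistent p01 dV eta0 d0) _.
by rewrite ler_wpM2r // ler_nat -[leqRHS]card_ord max_card.
Qed.

Theorem theorem3p5 (R : realType) (p : R) (nu1 nu2 : nat -> R)
    (V1 V2 : forall n, {set 'I_n}) (l1 l2 y : R) :
  0 < p < 1 ->
  (forall n, V1 n :|: V2 n = [set: 'I_n]%SET) ->
  (forall n, [disjoint V1 n & V2 n]) ->
  (forall n, #|V1 n|%:R = n%:R * nu1 n) ->
  (forall n, #|V2 n|%:R = n%:R * nu2 n) ->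
  (nu1 n @[n --> \oo] --> l1)%classic -> 0 < l1 ->
  (nu2 n @[n --> \oo] --> l2)%classic -> 0 < l2 ->
  (nu2 n / nu1 n @[n --> \oo] --> y)%classic -> 0 < y ->
  forall eps : R, 0 < eps ->
    almost_every_bipartite p V1 V2 (fun n G =>
      `| energy R G / n%:R `^ (3%:R / 2%:R)
         - 2%:R * nu2 n * Num.sqrt (nu1 n) * Lambda p y | <= eps).
Proof.
move=> p01 _ dV n1 n2 c1 l10 c2 _ cy y0 eps eps0.
have p01' : 0 <= p <= 1 by case/andP: p01 => /ltW -> /ltW ->.
have l2E : l2 = l1 * y.
  have cq : (nu2 n / nu1 n @[n --> \oo] --> l2 / l1)%classic.
    by apply: cvgM => //; apply: cvgV; rewrite ?gt_eqF.
  have -> : y = l2 / l1 by apply: (cvg_unique _ cy cq).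
  by rewrite mulrC divfK // gt_eqF.
set L := Lambda p y.
have cL : (2%:R * nu2 n * Num.sqrt (nu1 n) * L @[n --> \oo] -->
    2%:R * l2 * Num.sqrt l1 * L)%classic.
  apply: cvgMl; apply: cvgM; first exact: cvgMr.
  by apply: continuous_cvg => //; exact: sqrt_continuous.
pose C := l1 * (1 + Num.sqrt y) ^+ 2.
have C0 : 0 < C by rewrite mulr_gt0 // exprn_gt0 // ltr_pwDl ?sqrtr_ge0.
(* The discretization errors add up to at most [2h + 2(C h + C^2 h)], which this choice makes
   [eps / 3]. *)
pose h := eps / 3 / (2 + 2 * C + 2 * C ^+ 2).
have CC0 : 0 < 2 + 2 * C + 2 * C ^+ 2 by rewrite !addr_gt0 ?mulr_gt0 ?exprn_gt0.
have h0 : 0 < h by rewrite !divr_gt0.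
have hE : h * (2 + 2 * C + 2 * C ^+ 2) = eps / 3 by rewrite divfK ?gt_eqF.
clearbody h.
(* With [N > h^-2] the tail [(N h)^-1] is at most [h]; [h] and [N] depend on [eps] only and are
   fixed before [n] grows. *)
pose N := Num.bound (h ^- 2).
have hN : h ^- 2 < N%:R by apply: archi_boundP; rewrite invr_ge0 sqr_ge0.
have N0 : (0 < N)%N.
  by rewrite -(ltr_nat R) (le_lt_trans _ hN) // invr_ge0 sqr_ge0.
clearbody N.
have NR0 : 0 < N%:R :> R by rewrite ltr0n.
have Nh0 : 0 < N%:R * h by rewrite mulr_gt0.
have Nh : (N%:R * h)^-1 <= h.
  rewrite -[leRHS]invrK lef_pV2 ?posrE ?invr_gt0 //.
  have -> : h^-1 = h ^- 2 * h by field; rewrite gt_eqF.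
  by rewrite ler_pM2r // ltW.
apply/cvgrPdist_le => e e0.
(* The Markov bound will be [c0 * (d + K / n)]: [d] makes the first part [e / 2], and [K] collects
   the terms of order [1 / n], bounded uniformly because every node is at least [h]. *)
pose c0 := 6 / eps * h * N%:R.
have c00 : 0 < c0 by rewrite /c0 !mulr_gt0 ?invr_gt0.
pose d := e / (2 * c0).
have d0 : 0 < d by apply: divr_gt0 => //; apply: mulr_gt0.
pose K := 2 / h ^+ 4 / d + h ^- 2.
(* The errors [2 / n], [2 |nu1 - l1|] and [4 |nu2 - l1 y|] total at most [8 * rho] per node, hence
   [h * N * 8 * rho = eps / 6] over all nodes. *)
pose rho := eps / (48 * h * N%:R).
have rho0 : 0 < rho by rewrite /rho divr_gt0 ?mulr_gt0.
near=> n.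
have n0 : 1 <= n%:R :> R by near: n; apply: nbhs_infty_ger.
have nrho : rho^-1 <= n%:R by near: n; apply: nbhs_infty_ger.
have nK : 2 * c0 * K / e <= n%:R by near: n; apply: nbhs_infty_ger.
have nu1_gt0 : 0 < nu1 n by near: n; apply: (cvgr_gt _ c1).
have nu1_l1 : `|nu1 n - l1| <= rho by rewrite distrC; near: n; move/cvgrPdist_le : c1; apply.
have nu2_l2 : `|nu2 n - l1 * y| <= rho.
  by rewrite -l2E distrC; near: n; move/cvgrPdist_le : c2; apply.
have kappa : `|2%:R * l2 * Num.sqrt l1 * L - 2%:R * nu2 n * Num.sqrt (nu1 n) * L| <= eps / 6.
  by near: n; move/cvgrPdist_le : cL; apply; rewrite divr_gt0.
have nR0 : 0 < n%:R :> R by apply: lt_le_trans n0.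
have V10 : (0 < #|V1 n|)%N by rewrite -(ltr_nat R) n1 mulr_gt0.
pose D (j : 'I_N) w := self_consistent_defect p (V1 n) (V2 n) (n%:R * (j.+1%:R * h) ^+ 2) w / n%:R.
have D0 j w : 0 <= D j w by apply: divr_ge0; [exact: normr_ge0 | exact: ltW].
pose F w := \sum_(j < N) (6 / eps * h) * D j w.
pose Q (G : sgraph n) := `| energy R G / n%:R `^ (3%:R / 2%:R)
         - 2%:R * nu2 n * Num.sqrt (nu1 n) * L | <= eps.
(* An error above [eps], less [eps / 3] for discretization, [eps / 6] for the node errors and
   [eps / 6] for replacing [nu1], [nu2] by their limits, leaves at least [eps / 3] for the
   defects. *)
have FQ w : ~~ Q (sampled_graph (V1 n) (V2 n) w) -> 1 <= F w.
  rewrite -ltNge => big.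
  have := energy_approx w p01 l10 y0 h0 N0 (dV n) V10 (n1 n) (n2 n).
  have := Lambda_coulson p01 y0 l10 h0 N0.
  rewrite -/C -/L; set S := 2 / pi * (h * _).
  set E := energy R _ / _ in big *.
  set a := 2 / n%:R + 2 * `|nu1 n - l1| + 4 * `|nu2 n - l1 * y|.
  move=> h1 h2.
  pose X := h * \sum_(j < N) 2 * D j w.
  have {}h2 : `|E - 2 * S| <= h + (N%:R * h)^-1 + h * N%:R * a + X.
    apply: le_trans h2 _; rewrite big_split /= sumr_const card_ord -[a *+ N]mulr_natl.
    by rewrite mulrDr mulrA addrA.
  have FX : F w = 3 / eps * X.
    rewrite /F /X mulrA mulr_sumr; apply: eq_bigr => j _; field.
    by rewrite gt_eqF.
  suff hX : eps / 3 <= X.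
    have -> : 1 = 3 / eps * (eps / 3) by field; rewrite gt_eqF.
    by rewrite FX ler_pM2l // divr_gt0.
  have a_le : h * N%:R * a <= eps / 6.
    have n_inv : n%:R^-1 <= rho by rewrite -[rho]invrK lef_pV2 ?posrE ?invr_gt0.
    have -> : eps / 6 = h * N%:R * (8 * rho) by rewrite /rho; field; rewrite !gt_eqF.
    by rewrite ler_pM2l ?mulr_gt0 // /a; lra.
  have C_le : C / (N%:R * h) <= C * h by rewrite ler_pM2l.
  have CS : C * (h + C / (N%:R * h)) <= C * h + C ^+ 2 * h.
    by rewrite mulrDr lerD2l expr2 -mulrA ler_pM2l.
  have big3 : eps < `|E - 2 * S| + 2 * `|l1 * y * Num.sqrt l1 * L - S| + eps / 6.
    apply: lt_le_trans big _.
    have -> : E - 2%:R * nu2 n * Num.sqrt (nu1 n) * L =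
      (E - 2 * S) - 2 * (l1 * y * Num.sqrt l1 * L - S)
      + (2%:R * l2 * Num.sqrt l1 * L - 2%:R * nu2 n * Num.sqrt (nu1 n) * L).
      by rewrite l2E; ring.
    apply: le_trans (ler_normD _ _) _; apply: lerD => //.
    apply: le_trans (ler_normB _ _) _; rewrite lerD2l normrM ger0_norm //.
  move: hE Nh h1 h2 CS a_le big3; lra.
have EF : expect p F <= e.
  rewrite expect_sum.
  apply: (@le_trans _ _ (\sum_(j < N) (6 / eps * h) * (d + K / n%:R))).
    apply: ler_sum => j _; rewrite expectZ ler_pM2l ?mulr_gt0 ?invr_gt0 //.
    set t := j.+1%:R * h.
    have ht : h <= t by rewrite ler_peMl ?(ltW h0) // ler1n.
    have t0 : 0 < t by apply: lt_le_trans ht.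
    have eta0 : 0 < n%:R * t ^+ 2 by rewrite mulr_gt0 ?exprn_gt0.
    apply: le_trans (expect_defect_le p01' (dV n) eta0 d0) _.
    rewrite -addrA lerD2l /K [leRHS]mulrDl; apply: lerD.
      have -> : 2 * n%:R / (n%:R * t ^+ 2) ^+ 2 / d = 2 / t ^+ 4 / d / n%:R.
        by field; rewrite !gt_eqF.
      rewrite ler_pM2r ?invr_gt0 // ler_pM2r ?invr_gt0 // ler_pM2l //.
      by rewrite lef_pV2 ?posrE ?exprn_gt0 // lerXn2r ?nnegrE // ltW.
    rewrite invfM mulrC ler_pM2r ?invr_gt0 //.
    by rewrite lef_pV2 ?posrE ?exprn_gt0 // lerXn2r ?nnegrE // ltW.
  rewrite sumr_const card_ord -[_ *+ N]mulr_natl.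
  have -> : N%:R * (6 / eps * h * (d + K / n%:R)) = e / 2 + c0 * K / n%:R.
    by rewrite /d /c0; field; rewrite !gt_eqF.
  suff : c0 * K / n%:R <= e / 2 by lra.
  rewrite ler_pdivrMr //; move: nK; rewrite ler_pdivrMr //; lra.
rewrite -/(bipartite_prob p (V1 n) (V2 n) Q).
have F0 w : 0 <= F w.
  by apply: sumr_ge0 => j _; rewrite mulr_ge0 // mulr_ge0 ?(ltW h0) // divr_ge0 // ltW.
have ub := bipartite_prob_le1 Q p01' (dV n).
have lb := bipartite_prob_ge p01' (dV n) F0 FQ.
rewrite ger0_norm ?subr_ge0 //; move: lb EF.
set PQ := bipartite_prob _ _ _ _; lra.
Unshelve. all: by end_near.
Qed.
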